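(* Assume the Strong Exponential Time Hypothesis (SETH). Then for every function $f$ and every $\epsilon>0$, there is no algorithm that solves (IP) restricted to instances with non-negative constraint matrix in time $f(d)(d+1)^{(1-\epsilon)k}(mn)^{O(1)}$, where $A$ is the $m\times n$ constraint matrix, $d=\max\{b_1,\ldots,b_m\}$, and $k$ is the path-width of the column matroid of $A$.
   Context: (IP) is the decision problem: given an integer $m\times n$ matrix $A$ and an integer vector $b=(b_1,\dots,b_m)$, decide whether there exists $x\in\mathbb{Z}_{\ge0}^n$ with $Ax=b$. The column matroid $M(A)$ has the columns of $A$ as ground set $U$, with linearly independent sets of columns as independent sets; with rank function $r$, the connectivity function is $\lambda(X)=r(X)+r(U\setminus X)-r(U)+1$. A branch decomposition of $M(A)$ is a cubic tree $T$ with a map of $U$ into the leaves of $T$; each edge $e$ induces a partition $(X_e,U\setminus X_e)$ by the two components of $T-e$, of width $\lambda(X_e)$, and the decomposition's width is the maximum edge width. The path-width of $M(A)$ is the minimum width of a branch decomposition whose tree is a cubic caterpillar (a tree obtained from a path by attaching leaves). For $q\ge3$, $\delta_q$ is the infimum of constants $c$ such that $q$-SAT with $n$ variables and $m$ clauses is solvable in time $2^{cn}m^{O(1)}$; SETH is the conjecture $\lim_{q\to\infty}\delta_q=1$. *)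

(* Defs.v *)
From HB Require Import structures.
From mathcomp Require Import all_boot all_order all_algebra.
From mathcomp Require Import zify.
From mathcomp Require Import all_classical all_reals all_analysis.

Set Implicit Arguments.
Unset Strict Implicit.
Unset Printing Implicit Defensive.

Import Order.TTheory GRing.Theory Num.Theory.
Import numFieldNormedType.Exports.

(* Unit-cost random access machine with registers, an indirectly addressed
   memory and structured control flow.  Unit cost is only meaningful for words
   of bounded length, so [exec W] requires every value written during the run
   to be at most W; [decides] takes W polynomial in the input magnitude and the
   running time, i.e. words of logarithmic length. *)

Inductive binop := Add | Sub | Mul | Div.

(* Truncated subtraction; division by 0 returns 0. *)
Definition binop_sem (o : binop) : nat -> nat -> nat :=
  match o with Add => addn | Sub => subn | Mul => muln | Div => divn end.

Inductive expr :=
  | Const of nat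
  | Op of binop & nat & nat
  | Read of nat.

Inductive program :=
  | Assign of nat & expr
  | Write of nat & nat
  | Comp of program & program
  | If of nat & program & program
  | While of nat & program.

Record state := State { reg : nat -> nat; ram : nat -> nat }.

Definition update (g : nat -> nat) (i v : nat) : nat -> nat :=
  fun j => if j == i then v else g j.

Definition eval (s : state) (e : expr) : nat :=
  match e with
  | Const c => c
  | Op o y z => binop_sem o (reg s y) (reg s z)
  | Read y => ram s (reg s y)
  end.

(* [exec W p s t s'] : started in s, p halts in s' after t steps. *)
Inductive exec (W : nat) : program -> state -> nat -> state -> Prop :=
  | exec_assign s x e : eval s e <= W ->
      exec W (Assign x e) s 1 (State (update (reg s) x (eval s e)) (ram s))
  | exec_write s x y : reg s x <= W -> reg s y <= W ->
      exec W (Write x y) s 1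
        (State (reg s) (update (ram s) (reg s x) (reg s y)))
  | exec_comp p1 p2 s s1 s2 t1 t2 :
      exec W p1 s t1 s1 -> exec W p2 s1 t2 s2 ->
      exec W (Comp p1 p2) s (t1 + t2) s2
  | exec_if_true x p1 p2 s s' t : reg s x != 0 ->
      exec W p1 s t s' -> exec W (If x p1 p2) s t.+1 s'
  | exec_if_false x p1 p2 s s' t : reg s x = 0 ->
      exec W p2 s t s' -> exec W (If x p1 p2) s t.+1 s'
  | exec_while_done x p s : reg s x = 0 -> exec W (While x p) s 1 s
  | exec_while_step x p s s1 s2 t1 t2 : reg s x != 0 ->
      exec W p s t1 s1 -> exec W (While x p) s1 t2 s2 ->
      exec W (While x p) s (t1 + t2).+1 s2.

Definition init (input : seq nat) : state :=
  State (fun _ => 0) (fun i => nth 0 input i).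

Definition magnitude (input : seq nat) : nat :=
  size input + \max_(v <- input) v.

(* p halts on the input after t steps, using words of at most
   C * log (magnitude + t + 2) bits, and register 0 holds the answer. *)
Definition decides (p : program) (C : nat) (input : seq nat) (answer : Prop)
    (t : nat) : Prop :=
  exists2 s : state,
    exec ((magnitude input + t + 2) ^ C) p (init input) t s &
    (reg s 0 != 0 <-> answer).

(* The literal (i, true) is the i-th variable, (i, false) its negation. *)
Definition clause (n : nat) := seq ('I_n * bool).
Definition cnf (n : nat) := seq (clause n).

Definition is_qcnf (q n : nat) (F : cnf n) : bool :=
  all (fun c => size c <= q) F.

Definition satisfiable (n : nat) (F : cnf n) : Prop :=
  exists v : 'I_n -> bool, all (has (fun l => v l.1 == l.2)) F.

Definition encode_clause (n : nat) (c : clause n) : seq nat :=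
  size c :: flatten [seq [:: nat_of_ord l.1; nat_of_bool l.2] | l <- c].

Definition encode_cnf (n : nat) (F : cnf n) : seq nat :=
  [:: n; size F] ++ flatten [seq encode_clause c | c <- F].

Local Open Scope ring_scope.

(* q-SAT is solvable in time 2^(c n) m^O(1); the constant factor and the
   shift (m + 1) only account for the smallest instances. *)
Definition qsat_solvable (R : realType) (q : nat) (c : R) : Prop :=
  exists (p : program) (C : nat), forall (n : nat) (F : cnf n),
    is_qcnf q F ->
    exists2 t : nat, decides p C (encode_cnf F) (satisfiable F) t &
      t%:R <= C%:R * (2 `^ (c * n%:R)) * ((size F).+1%:R ^+ C).

Definition delta (R : realType) (q : nat) : \bar R :=
  ereal_inf [set c%:E | c in [set c : R | qsat_solvable q c]].

Definition SETH (R : realType) : Prop :=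
  (delta R q @[q --> \oo] --> 1%:E)%classic.

Definition ip_feasible (m n : nat) (A : 'M[int]_(m, n)) (b : 'cV[int]_m) :
    Prop :=
  exists2 x : 'cV[int]_n, (forall j, 0 <= x j 0) & A *m x = b.

Definition encode_int (z : int) : seq nat := [:: nat_of_bool (z < 0); `|z|%N].

Definition encode_ip (m n : nat) (A : 'M[int]_(m, n)) (b : 'cV[int]_m) :
    seq nat :=
  [:: m; n]
  ++ flatten [seq flatten [seq encode_int (A i j) | j <- enum 'I_n]
                 | i <- enum 'I_m]
  ++ flatten [seq encode_int (b i 0) | i <- enum 'I_m].

Definition max_entry (m : nat) (b : 'cV[int]_m.+1) : int :=
  \big[Num.max/b ord0 0]_(i < m.+1) b i 0.

Local Close Scope ring_scope.

(* A matroid on the ground set U is given by its independent sets. *)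

Definition matroid_rank (U : finType) (indep : pred {set U}) (X : {set U}) :
    nat :=
  \max_(Y : {set U} | (Y \subset X) && indep Y) #|Y|.

(* Subadditivity of the rank makes the natural subtraction exact. *)
Definition connectivity (U : finType) (indep : pred {set U}) (X : {set U}) :
    nat :=
  matroid_rank indep X + matroid_rank indep (~: X)
    - matroid_rank indep [set: U] + 1.

(* Independence is over rat; the index set 'I_n keeps equal columns apart. *)
Definition column_matroid (m n : nat) (A : 'M[int]_(m, n)) : pred {set 'I_n} :=
  fun X => free [seq col j (map_mx (intr : int -> rat) A) | j <- enum X].

Definition degree (V : finType) (e : rel V) (x : V) : nat :=
  #|[set y | e x y]|.

Definition is_tree (V : finType) (e : rel V) : Prop :=
  [/\ symmetric e, irreflexive e, (forall x y, connect e x y)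
    & forall c : seq V, ucycle e c -> size c <= 2].

Definition is_cubic (V : finType) (e : rel V) : Prop :=
  forall x, degree e x = 1 \/ degree e x = 3.

Definition is_caterpillar (V : finType) (e : rel V) : Prop :=
  exists (x : V) (p : seq V),
    [/\ path e x p, uniq (x :: p)
      & forall v, v \notin x :: p ->
          degree e v = 1 /\ exists2 y, y \in x :: p & e v y].

Record branch_decomposition (U : finType) := BranchDecomposition {
  node : finType;
  edge : rel node;
  place : U -> node;
  edge_tree : is_tree edge;
  edge_cubic : is_cubic edge;
  place_inj : injective place;
  place_leaf : forall u, degree edge (place u) = 1
}.

(* The elements placed in the component of x after deleting the edge xy. *)
Definition edge_side (U : finType) (D : branch_decomposition U)
    (x y : node D) : {set U} :=
  let cut := [rel v w | edge v w && ([set v; w] != [set x; y])] in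
  [set u | connect cut x (place D u)].

Definition width (U : finType) (indep : pred {set U})
    (D : branch_decomposition U) : nat :=
  \max_(xy : node D * node D | edge xy.1 xy.2)
    connectivity indep (edge_side xy.1 xy.2).

(* Spine vertices inl 0, ..., inl (N + 1), with a leaf inr j attached to
   inl (j + 1); the two ends of the spine are leaves. *)
Section CaterpillarExists.
Variable N : nat.
Local Notation V := ('I_N.+2 + 'I_N)%type.

Let e : rel V := fun x y =>
  match x, y with
  | inl a, inl b => (a.+1 == b) || (b.+1 == a)
  | inl a, inr j => a == j.+1 :> nat
  | inr j, inl a => a == j.+1 :> nat
  | inr _, inr _ => false
  end.

Let rk (x : V) : nat :=
  match x with inl a => a.*2 | inr j => (j.+1).*2.+1 end.

Let e_sym : symmetric e.
Proof. by move=> [a|i] [b|j] //=; rewrite orbC. Qed.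

Let e_irr : irreflexive e.
Proof. by move=> [a|i] //=; apply/negbTE; lia. Qed.

Let e_rk x y : e x y -> rk x != rk y.
Proof. by case: x => [a|i]; case: y => [b|j] //= H; lia. Qed.

Let e_parent x y z : e x y -> e x z -> rk y < rk x -> rk z < rk x -> y = z.
Proof.
case: x => [a|i]; case: y => [b|j]; case: z => [c|k] //= Hy Hz Ly Lz;
  try lia; by congr inl; apply: val_inj => /=; lia.
Qed.

Let e_connect x y : connect e x y.
Proof.
have root z : connect e z (inl ord0).
  have spine k (Hk : k < N.+2) : connect e (inl (Ordinal Hk)) (inl ord0).
    elim: k Hk => [|k IH] Hk.
      by rewrite (_ : Ordinal Hk = ord0) //; apply: val_inj.
    have Hk' : k < N.+2 by lia.
    apply: connect_trans (IH Hk'); apply: connect1 => /=.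
    by rewrite eqxx orbT.
  case: z => [[k Hk]|j]; first exact: spine.
  have Hj : j.+1 < N.+2 by rewrite ltnS ltnS ltnW.
  by apply: connect_trans (spine _ Hj); apply: connect1 => /=.
apply: connect_trans (root x) _.
by rewrite (sym_connect_sym e_sym).
Qed.

Let e_acyclic (c : seq V) : ucycle e c -> size c <= 2.
Proof.
move=> /andP[cyc unq]; case: c cyc unq => [|x0 c0] // cyc unq.
set c := x0 :: c0 in cyc unq *.
have x0c : x0 \in c by rewrite mem_head.
case: (@arg_maxnP _ x0 (mem c) rk x0c) => x xc xmax.
have [i c' cE] := rot_to xc.
have cyc' : cycle e (x :: c') by rewrite -cE rot_cycle.
have unq' : uniq (x :: c') by rewrite -cE rot_uniq.
have mem' z : z \in c' -> rk z <= rk x.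
  move=> zc; apply: xmax; change (z \in c).
  by rewrite -(mem_rot i) cE inE zc orbT.
rewrite -(size_rot i) cE.
case: c' {cE} cyc' unq' mem' => [|y c'] //.
case: (lastP c') => [|c'' z] // cyc' unq' mem'.
move: cyc'; rewrite /= !rcons_path last_rcons => /and3P[exy _ ezx].
have exz : e x z by rewrite e_sym.
have Ly : rk y < rk x.
  by rewrite ltn_neqAle eq_sym e_rk //= mem' // mem_head.
have Lz : rk z < rk x.
  by rewrite ltn_neqAle eq_sym e_rk //= mem' // inE mem_rcons mem_head orbT.
move: unq'; rewrite (e_parent exy exz Ly Lz) /=.
by rewrite mem_rcons mem_head andbF.
Qed.

Let degree_leaf (j : 'I_N) : degree e (inr j) = 1.
Proof.
have Hj : j.+1 < N.+2 by rewrite ltnS ltnS ltnW.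
rewrite /degree (_ : [set y | _] = [set inl (Ordinal Hj)]) ?cards1 //.
by apply/setP => -[b|k]; rewrite !inE /=.
Qed.

Let inlE (a b : 'I_N.+2) : (inl a == inl b :> V) = (a == b :> nat).
Proof. by []. Qed.

Let inrE (i j : 'I_N) : (inr i == inr j :> V) = (i == j :> nat).
Proof. by []. Qed.

Let inlrE (a : 'I_N.+2) (j : 'I_N) :
  ((inl a == inr j :> V) = false) * ((inr j == inl a :> V) = false).
Proof. by []. Qed.

Let e_cubic : is_cubic e.
Proof.
case=> [[a Ha]|j]; last by left; exact: degree_leaf.
rewrite /degree; case: (posnP a) => [a0|a_gt0].
  left; have H1 : 1 < N.+2 by [].
  rewrite (_ : [set y | _] = [set inl (Ordinal H1)]) ?cards1 //.
  by apply/setP => -[b|k]; rewrite !inE ?inlE ?inrE ?inlrE /=; lia.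
have Hp : a.-1 < N.+2 by lia.
case: (eqVneq a N.+1) => [aN|aN].
  left; rewrite (_ : [set y | _] = [set inl (Ordinal Hp)]) ?cards1 //.
  by apply/setP => -[b|k]; rewrite !inE ?inlE ?inrE ?inlrE /=;
    [have := ltn_ord b | have := ltn_ord k]; lia.
right.
have Hs : a.+1 < N.+2 by lia.
have Hl : a.-1 < N by lia.
rewrite (_ : [set y | _] =
  inl (Ordinal Hp) |: [set inl (Ordinal Hs); inr (Ordinal Hl)]).
  rewrite cardsU1 cards2 !inE !inlE !inlrE /=.
  by have -> : (a.-1 == a.+1) = false by lia.
by apply/setP => -[b|k]; rewrite !inE ?inlE ?inrE ?inlrE /=; lia.
Qed.

Let e_caterpillar : is_caterpillar e.
Proof.
have spine : exists p : seq V, [/\ path e (inl ord0) p,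
    uniq ((inl ord0 : V) :: p) & forall a, inl a \in (inl ord0 : V) :: p].
  pose s := [seq (inl (inord i) : V) | i <- iota 0 N.+2].
  have sE : s = (inl ord0 : V) :: [seq inl (inord i) | i <- iota 1 N.+1].
    rewrite /s /=; congr (_ :: _); congr inl.
    by apply: val_inj; rewrite /= inordK.
  exists [seq inl (inord i) | i <- iota 1 N.+1]; rewrite -sE; split.
  - change (sorted e ((inl ord0 : V) :: [seq inl (inord i) | i <- iota 1 N.+1])).
    rewrite -sE; apply/(sortedP (inl ord0)) => i.
    rewrite size_map size_iota => Hi.
    rewrite !(nth_map 0) ?size_iota ?(ltnW Hi) //.
    by rewrite !nth_iota ?(ltnW Hi) //= !add0n !inordK ?(ltnW Hi) // eqxx.
  - rewrite map_inj_in_uniq ?iota_uniq // => i j.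
    rewrite !mem_iota !add0n /= => Hi Hj [] /(congr1 val) /=.
    by rewrite !inordK.
  - move=> a; apply/mapP; exists (val a); last by rewrite inord_val.
    by rewrite mem_iota /= add0n ltn_ord.
case: spine => p [Hp Hu Hm]; exists (inl ord0), p; split=> // -[a|j].
  by rewrite Hm.
move=> _; split; first exact: degree_leaf.
have Hj : j.+1 < N.+2 by rewrite ltnS ltnS ltnW.
by exists (inl (Ordinal Hj)); [exact: Hm | rewrite /=].
Qed.

Lemma caterpillar_exists (U : finType) : #|U| = N ->
  exists D : branch_decomposition U, is_caterpillar (@edge U D).
Proof.
move=> UN.
have inj : injective (fun u : U => inr (cast_ord UN (enum_rank u)) : V).
  by move=> u v [] H; apply/enum_rank_inj/val_inj.
have tree : is_tree e by split.
by exists (BranchDecomposition tree e_cubic inj (fun u => degree_leaf _)).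
Qed.

End CaterpillarExists.

Definition caterpillar_width (U : finType) (indep : pred {set U}) : pred nat :=
  fun k => `[< exists2 D : branch_decomposition U,
                 is_caterpillar (@edge U D) & width indep D = k >].

Lemma caterpillar_width_exists (U : finType) (indep : pred {set U}) :
  exists k, caterpillar_width indep k.
Proof.
have [D HD] := caterpillar_exists (erefl #|U|).
by exists (width indep D); apply/asboolP; exists D.
Qed.

Definition path_width (U : finType) (indep : pred {set U}) : nat :=
  ex_minn (caterpillar_width_exists indep).

(* Main.v *)
Require Import Defs.
From mathcomp Require Import all_boot all_order all_algebra.
From mathcomp Require Import all_classical all_reals all_analysis.
From mathcomp Require Import zify ring lra.

(* A q-CNF F with n variables and m clauses is turned into a non-negative
   system with all right-hand sides 1, hence d = 1, whose path-width is at most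
   n + q + 5, so that a running time f(d) (d+1)^((1-eps)k) becomes
   2^((1-eps)n) up to polynomial factors.
   The system has one cell (j, i) per layer j = 0, ..., m and variable i, with
   four 0/1 columns: the value a of variable i in layer j, and a mark w saying
   that i is the chosen witness for clause j.  Rows force exactly one column per
   cell, equal values of a variable in consecutive layers, and exactly one
   witness for each clause; the coefficient of a marked column in a clause row
   is 1 if the literal (i, a) occurs in the clause and 2 otherwise, which
   excludes the column.  In the order of the cells, only the n or so rows linking
   two layers, one cell row and one clause row meet both sides of a cut, and the
   intersection of the two column spaces lives on these rows.
   The variables are padded to N = n + q + 1, so that the input of the reduction
   is shorter than the first row of the matrix: it can be overwritten last. *)

Set Implicit Arguments.
Unset Strict Implicit.
Unset Printing Implicit Defensive.

Import Order.TTheory GRing.Theory Num.Theory.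

(** * Compiling expressions to the random access machine *)

Lemma exec_leW W W' p s t s' : W <= W' -> exec W p s t s' -> exec W' p s t s'.
Proof.
move=> leW; elim=> {p s t s'} *; try by econstructor; eauto; apply: leq_trans leW.
Qed.

Fixpoint nregs (p : program) : nat :=
  match p with
  | Assign x _ => x.+1
  | Write _ _ => 0
  | Comp p1 p2 | If _ p1 p2 => maxn (nregs p1) (nregs p2)
  | While _ p1 => nregs p1
  end.

(** A program names only finitely many registers. Those from [nregs p] on keep their initial 0, so
    clearing the others restores the registers of [init] between two programs. *)
Lemma exec_reg_ge W p s t s' : exec W p s t s' ->
  forall x, nregs p <= x -> reg s' x = reg s x.
Proof.
elim=> {p s t s'} //=.
- by move=> s x e _ y xy; rewrite /update gtn_eqF.
- by move=> p1 p2 s s1 s2 t1 t2 _ IH1 _ IH2 x; rewrite geq_max => /andP[? ?]; rewrite IH2 ?IH1.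
- by move=> x p1 p2 s s' t _ _ IH y; rewrite geq_max => /andP[? ?]; rewrite IH.
- by move=> x p1 p2 s s' t _ _ IH y; rewrite geq_max => /andP[? ?]; rewrite IH.
- by move=> x p s s1 s2 t1 t2 _ _ IH1 _ IH2 y ?; rewrite IH2 ?IH1.
Qed.

(** There is no empty program, so the base case clears register 0; this is where the [maxn k 1]
    below comes from. *)
Fixpoint clear_regs (k : nat) : program :=
  if k is k'.+1 then Comp (Assign k' (Const 0)) (clear_regs k')
  else Assign 0 (Const 0).

Lemma exec_clear_regs W k s :
  exec W (clear_regs k) s k.+1
    (State (fun x => if x < maxn k 1 then 0 else reg s x) (ram s)).
Proof.
elim: k s => [|k IH] s /=.
  have -> : (fun x => if x < maxn 0 1 then 0 else reg s x) = update (reg s) 0 0.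
    by apply: funext => -[].
  exact: (@exec_assign W s 0 (Const 0)).
rewrite -add1n; apply: exec_comp; first exact: (@exec_assign W s k (Const 0)).
set u := State _ _.
have -> : (fun x => if x < maxn k.+1 1 then 0 else reg s x)
        = (fun x => if x < maxn k 1 then 0 else reg u x).
  apply: funext => x; rewrite /u /= /update.
  by case: eqP => [->|?]; case: ltnP => ?; case: ltnP => ? //; lia.
exact: (IH u).
Qed.

Inductive aexp :=
  | Cst of nat
  | Var of nat
  | Bin of binop & aexp & aexp
  | Mem of aexp.

(** The registers that hold program variables, as a finite list, and the memory. Temporaries are
    deliberately left out. *)
Definition store_state : Type := seq nat * (nat -> nat).

Fixpoint aval (st : store_state) (e : aexp) : nat :=
  match e with
  | Cst c => c
  | Var x => nth 0 st.1 x
  | Bin o e1 e2 => binop_sem o (aval st e1) (aval st e2)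
  | Mem e1 => st.2 (aval st e1)
  end.

(* The result goes to register d, the registers above d serve as temporaries. *)
Fixpoint eval_code (d : nat) (e : aexp) : program :=
  match e with
  | Cst c => Assign d (Const c)
  | Var x => Comp (Assign d (Const 0)) (Assign d (Op Add x d))
  | Bin o e1 e2 =>
      Comp (eval_code d e1) (Comp (eval_code d.+1 e2) (Assign d (Op o d d.+1)))
  | Mem e1 => Comp (eval_code d e1) (Assign d (Read d))
  end.

Fixpoint cost (e : aexp) : nat :=
  match e with
  | Cst _ => 1
  | Var _ => 2
  | Bin _ e1 e2 => cost e1 + (cost e2 + 1)
  | Mem e1 => cost e1 + 1
  end.

Fixpoint vars_lt (D : nat) (e : aexp) : bool :=
  match e with
  | Cst _ => true
  | Var x => x < D
  | Bin _ e1 e2 => vars_lt D e1 && vars_lt D e2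
  | Mem e1 => vars_lt D e1
  end.

(* Values up to V in the variables and in memory give [aval] at most
   V ^ weight; a constant c is covered by c <= 2 ^ c <= V ^ c. *)
Fixpoint weight (e : aexp) : nat :=
  match e with
  | Cst c => c.+1
  | Var _ => 1
  | Bin _ e1 e2 => weight e1 + weight e2
  | Mem e1 => weight e1
  end.

Lemma weight_gt0 e : 0 < weight e.
Proof. by elim: e => //= _ e1 IH1 e2 _; rewrite addn_gt0 IH1. Qed.

Definition bounded (V : nat) (st : store_state) : Prop :=
  all (fun v => v <= V) st.1 /\ forall a, st.2 a <= V.

(** Exponents add up under products. Sums obey the same bound, since x + y <= x * y once both
    factors are at least 2; subtraction and division do not exceed their first argument. *)
Lemma aval_le V st e : 1 < V -> bounded V st -> aval st e <= V ^ weight e.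
Proof.
move=> V1 [/allP l_le g_le].
have V0 : 0 < V by exact: ltnW.
have VX k : 0 < k -> V <= V ^ k by move=> k0; rewrite -{1}(expn1 V) leq_pexp2l.
elim: e => [c|x|o e1 IH1 e2 IH2|e _] /=.
- by rewrite ltnW // (leq_trans (ltnSn _)) // ltnW // ltn_expl.
- rewrite expn1; case: (ltnP x (size st.1)) => [xl|xl]; last by rewrite nth_default.
  exact/l_le/mem_nth.
- have E1 := VX _ (weight_gt0 e1); have E2 := VX _ (weight_gt0 e2).
  rewrite expnD; case: o => /=.
  + by apply: leq_trans (leq_add IH1 IH2) _; nia.
  + by apply: leq_trans (leq_subr _ _) _; nia.
  + exact: leq_mul.
  + by apply: leq_trans (leq_div _ _) _; nia.
- exact: leq_trans (g_le _) (VX _ (weight_gt0 e)).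
Qed.

Definition represents (st : store_state) (s : state) : Prop :=
  (forall x, x < size st.1 -> reg s x = nth 0 st.1 x) /\ ram s = st.2.

(** The clause on registers below [d] carries the induction: it protects the variables, and also the
    first operand of a [Bin] while the second is computed one register higher. *)
Lemma eval_codeP V w st e d s : 1 < V -> bounded V st -> weight e <= w ->
    size st.1 <= d -> vars_lt (size st.1) e -> represents st s ->
  exists2 s', exec (V ^ w) (eval_code d e) s (cost e) s' &
    [/\ ram s' = ram s, reg s' d = aval st e &
        forall x, x < d -> reg s' x = reg s x].
Proof.
move=> V1 Vst; have V0 : 0 < V by exact: ltnW.
have le_aval e1 : weight e1 <= w -> aval st e1 <= V ^ w.
  by move=> ew; apply: leq_trans (aval_le _ V1 Vst) _; rewrite leq_pexp2l.
elim: e d s => [c|x|o e1 IH1 e2 IH2|e IH] d s we sd ve rep_s /=.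
- exists (State (update (reg s) d c) (ram s)).
    by apply: (@exec_assign _ s d (Const c)); apply: (le_aval (Cst c)).
  split=> //=; first by rewrite /update eqxx.
  by move=> x xd; rewrite /update ltn_eqF.
- have xd : x < d by exact: leq_trans sd.
  pose s1 := State (update (reg s) d 0) (ram s).
  have Ex : reg s1 x + reg s1 d = nth 0 st.1 x.
    by rewrite /= /update (ltn_eqF xd) eqxx addn0 (proj1 rep_s).
  exists (State (update (reg s1) d (nth 0 st.1 x)) (ram s)).
    rewrite -[2]/(1 + 1); apply: (@exec_comp _ _ _ _ s1).
      exact: (@exec_assign _ s d (Const 0)).
    rewrite -Ex; apply: (@exec_assign _ s1 d (Op Add x d)) => /=.
    rewrite -[X in X <= _]/(reg s1 x + reg s1 d) Ex; exact: (le_aval (Var x)).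
  split=> //=; first by rewrite /update eqxx.
  by move=> y yd; rewrite /update ltn_eqF.
- case/andP: ve => v1 v2; rewrite /= in we.
  have [|s1 ex1 [ram1 d1 fr1]] := IH1 d s _ sd v1 rep_s; first by lia.
  have rep1 : represents st s1.
    by case: rep_s => h1 h2; split=> [x xs|]; rewrite ?ram1 // fr1 ?h1 //; apply: leq_trans sd.
  have [|s2 ex2 [ram2 d2 fr2]] := IH2 d.+1 s1 _ (leqW sd) v2 rep1; first by lia.
  have E : binop_sem o (reg s2 d) (reg s2 d.+1) = aval st (Bin o e1 e2).
    by rewrite d2 fr2 // d1.
  exists (State (update (reg s2) d (aval st (Bin o e1 e2))) (ram s2)).
    apply: exec_comp ex1 _; apply: exec_comp ex2 _; rewrite -E.
    apply: (@exec_assign _ s2 d (Op o d d.+1)) => /=; rewrite E; exact: le_aval.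
  split=> /=; rewrite ?ram2 //; first by rewrite /update eqxx.
  by move=> x xd; rewrite /update ltn_eqF // fr2 ?fr1 // ltnW.
- have [s1 ex1 [ram1 d1 fr1]] := IH d s we sd ve rep_s.
  have E : ram s1 (reg s1 d) = aval st (Mem e) by rewrite d1 ram1 (proj2 rep_s).
  exists (State (update (reg s1) d (aval st (Mem e))) (ram s1)).
    apply: exec_comp ex1 _; rewrite -E.
    apply: (@exec_assign _ s1 d (Read d)) => /=; rewrite E; exact: le_aval.
  split=> /=; rewrite ?ram1 //; first by rewrite /update eqxx.
  by move=> x xd; rewrite /update ltn_eqF // fr1.
Qed.

(** The machine has no copy instruction: the target is set to 0 and the computed value is added to
    it. *)
Definition assign_var (D x : nat) (e : aexp) : program :=
  Comp (eval_code D e) (Comp (Assign x (Const 0)) (Assign x (Op Add x D))).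

Definition assign_mem (D : nat) (a e : aexp) : program :=
  Comp (eval_code D a) (Comp (eval_code D.+1 e) (Write D D.+1)).

Section Steps.
Variables V w : nat.
Hypothesis V_gt1 : 1 < V.

(** A Hoare-style judgement. Quantifying over all machine states that represent [st] hides the
    temporaries, and [T] is only an upper bound, so that costs may be rounded up. *)
Definition steps (p : program) (st : store_state) (T : nat)
    (st' : store_state) : Prop :=
  forall s, represents st s -> exists t s',
    [/\ exec (V ^ w) p s t s', t <= T & represents st' s'].

Lemma steps_comp p1 p2 st st1 st2 T1 T2 :
  steps p1 st T1 st1 -> steps p2 st1 T2 st2 ->
  steps (Comp p1 p2) st (T1 + T2) st2.
Proof.
move=> H1 H2 s /H1[t1 [s1 [ex1 le1 /H2[t2 [s2 [ex2 le2 rep2]]]]]].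
by exists (t1 + t2), s2; split=> //; [apply: exec_comp ex1 ex2 | rewrite leq_add].
Qed.

Lemma steps_assign_var x e st : bounded V st -> weight e <= w ->
    vars_lt (size st.1) e -> x < size st.1 ->
  steps (assign_var (size st.1) x e) st (cost e + 2)
    (set_nth 0 st.1 x (aval st e), st.2).
Proof.
move=> Vst we ve xD s rep_s.
have [s1 ex1 [ram1 d1 fr1]] := eval_codeP V_gt1 Vst we (leqnn _) ve rep_s.
pose s2 := State (update (reg s1) x 0) (ram s1).
have E : reg s2 x + reg s2 (size st.1) = aval st e.
  by rewrite /= /update eqxx gtn_eqF.
have W_ge : aval st e <= V ^ w.
  by apply: leq_trans (aval_le _ V_gt1 Vst) _; rewrite leq_pexp2l // ltnW.
exists (cost e + 2), (State (update (reg s2) x (aval st e)) (ram s1)).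
split=> //.
  apply: exec_comp ex1 _; rewrite -[2]/(1 + 1); apply: (@exec_comp _ _ _ _ s2).
    exact: (@exec_assign _ s1 x (Const 0)).
  rewrite -E; apply: (@exec_assign _ s2 x (Op Add x (size st.1))) => /=.
  by rewrite -[X in X <= _]/(reg s2 x + reg s2 (size st.1)) E.
split=> /= [y|]; last by rewrite ram1 (proj2 rep_s).
rewrite size_set_nth (maxn_idPr xD) nth_set_nth /= /update => yD.
by case: eqP => // _; rewrite fr1 // (proj1 rep_s).
Qed.

Lemma steps_assign_mem a e st : bounded V st -> weight a <= w -> weight e <= w ->
    vars_lt (size st.1) a -> vars_lt (size st.1) e ->
  steps (assign_mem (size st.1) a e) st (cost a + (cost e + 1))
    (st.1, update st.2 (aval st a) (aval st e)).
Proof.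
move=> Vst wa we va ve s rep_s.
have le_W e' : weight e' <= w -> aval st e' <= V ^ w.
  by move=> ?; apply: leq_trans (aval_le _ V_gt1 Vst) _; rewrite leq_pexp2l // ltnW.
have [s1 ex1 [ram1 d1 fr1]] := eval_codeP V_gt1 Vst wa (leqnn _) va rep_s.
have rep1 : represents st s1.
  by case: rep_s => h1 h2; split=> [x xs|]; rewrite ?ram1 // fr1 ?h1.
have [s2 ex2 [ram2 d2 fr2]] := eval_codeP V_gt1 Vst we (leqnSn _) ve rep1.
have Ea : reg s2 (size st.1) = aval st a by rewrite fr2.
exists (cost a + (cost e + 1)), (State (reg s2) (update (ram s2) (aval st a) (aval st e))).
split=> //.
  apply: exec_comp ex1 _; apply: exec_comp ex2 _; rewrite -Ea -d2.
  by apply: exec_write; rewrite ?Ea ?d2 le_W.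
split=> /= [x xs|]; last by rewrite ram2 ram1 (proj2 rep_s).
by rewrite fr2 ?fr1 ?(proj1 rep_s) // ltnW.
Qed.

Lemma steps_while_done x p st : nth 0 st.1 x = 0 -> x < size st.1 ->
  steps (While x p) st 1 st.
Proof.
move=> x0 xD s rep_s; exists 1, s; split=> //; apply: exec_while_done.
by rewrite (proj1 rep_s).
Qed.

Lemma steps_while_step x p st st1 st2 T1 T2 :
    nth 0 st.1 x != 0 -> x < size st.1 ->
    steps p st T1 st1 -> steps (While x p) st1 T2 st2 ->
  steps (While x p) st (T1.+1 + T2) st2.
Proof.
move=> x0 xD H1 H2 s rep_s.
have [t1 [s1 [ex1 le1 /H2[t2 [s2 [ex2 le2 rep2]]]]]] := H1 s rep_s.
exists (t1 + t2).+1, s2; split=> //; last by rewrite -addSn leq_add.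
by apply: exec_while_step ex1 ex2; rewrite (proj1 rep_s).
Qed.

Lemma steps_while x p (st : nat -> store_state) n T :
    (forall i, i < n -> nth 0 (st i).1 x != 0 /\ x < size (st i).1) ->
    (forall i, i < n -> steps p (st i) T (st i.+1)) ->
    nth 0 (st n).1 x = 0 -> x < size (st n).1 ->
  steps (While x p) (st 0) (n * T.+1 + 1) (st n).
Proof.
elim: n st => [|n IH] st cond body last xn; first exact: steps_while_done.
have [c0 x0] := cond 0 isT.
rewrite mulSn -addnA; apply: (steps_while_step c0 x0 (body 0 isT)).
by apply: (IH (fun i => st i.+1)) => // i Hi; [apply: cond | apply: body].
Qed.

Lemma steps_leT p st T T' st' : T <= T' -> steps p st T st' -> steps p st T' st'.
Proof.
move=> leT H s /H[t [s' [ex le rep]]]; exists t, s'; split=> //.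
exact: leq_trans leT.
Qed.

End Steps.

(** * The reduction program *)

Definition ncells (N m : nat) : nat := m.+1 * N.
Definition ncols (N m : nat) : nat := 4 * ncells N m.
Definition nrows (N m : nat) : nat := ncells N m + m * N + m.

(* The rows are [ncells] cell rows, then m * N link rows, then m clause rows.
   Column c lies in the cell c %/ 4, with value odd c and mark odd (c %/ 2). *)
Definition base_entry (N m r c : nat) : nat :=
  (r == c %/ 4)
  + [&& ncells N m <= r, r < ncells N m + m * N &
        if odd c then r == ncells N m + c %/ 4 else r + N == ncells N m + c %/ 4]
  + 2 * (odd (c %/ 2) && (r == ncells N m + m * N + c %/ 4 %/ N)).

(* The matrix in row-major order, followed by the right-hand sides; the clause
   coefficients at the positions [lit_index] still have to be lowered to 1. *)
Definition base_value (N m k : nat) : nat :=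
  if k %/ ncols N m < nrows N m
  then base_entry N m (k %/ ncols N m) (k %% ncols N m) else 1.

Lemma base_entry_le N m r c : base_entry N m r c <= 4.
Proof.
rewrite /base_entry; set b1 := (_ == _); set b2 := [&& _, _ & _]; set b3 := (_ && _).
by case: b1; case: b2; case: b3.
Qed.

Lemma base_value_le N m k : base_value N m k <= 4.
Proof. by rewrite /base_value; case: ifP => // _; exact: base_entry_le. Qed.

(** Position in the flattened matrix where clause row j meets the marked column of cell (j, l.1)
    with value l.2; within a cell, the mark counts 2 and the value counts 1. *)
Definition lit_index (N m n j : nat) (l : 'I_n * bool) : nat :=
  (ncells N m + m * N + j) * ncols N m + (4 * (j * N + l.1) + 2 + l.2).

Fixpoint lit_indices (N m n j : nat) (F : cnf n) : seq nat :=
  if F is c :: F' then [seq lit_index N m j l | l <- c] ++ lit_indices N m j.+1 F'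
  else [::].

(** Comparisons as 0/1 arithmetic: truncated differences vanish exactly when the comparison holds,
    and 1 minus them is then 1. *)
Definition eq_exp (e1 e2 : aexp) : aexp :=
  Bin Defs.Sub (Cst 1) (Bin Add (Bin Defs.Sub e1 e2) (Bin Defs.Sub e2 e1)).
Definition lt_exp (e1 e2 : aexp) : aexp :=
  Bin Defs.Sub (Cst 1) (Bin Defs.Sub (Bin Add e1 (Cst 1)) e2).

Lemma aval_eq_exp st e1 e2 : aval st (eq_exp e1 e2) = (aval st e1 == aval st e2).
Proof. by rewrite /=; case: eqP; lia. Qed.

Lemma aval_lt_exp st e1 e2 : aval st (lt_exp e1 e2) = (aval st e1 < aval st e2).
Proof. by rewrite /=; case: ltnP; lia. Qed.

Lemma aval_Bin st o e1 e2 :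
  aval st (Bin o e1 e2) = binop_sem o (aval st e1) (aval st e2).
Proof. by []. Qed.

(* The registers from 9 on are temporaries of [eval_code]. *)
Definition vN := Var 0.
Definition vm := Var 1.
Definition vS := Var 2.
Definition vR := Var 3.
Definition vk := Var 4.
Definition vcount := Var 5.
Definition vptr := Var 6.
Definition vclauses := Var 7.
Definition vlits := Var 8.

Definition set9 := assign_var 9.
Definition mem9 := assign_mem 9.

Definition cols_exp := Bin Mul (Cst 4) vS.
Definition row_exp := Bin Div vk cols_exp.
Definition col_exp := Bin Defs.Sub vk (Bin Mul row_exp cols_exp).
Definition bit_exp d e := Bin Defs.Sub (Bin Div e (Cst d)) (Bin Mul (Cst 2) (Bin Div e (Cst d.*2))).
Definition link_top_exp := Bin Add vS (Bin Mul vm vN).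
Definition entry_exp : aexp :=
  let s := Bin Div col_exp (Cst 4) in
  Bin Add (Bin Add
   (eq_exp row_exp s)
   (Bin Mul (Bin Mul (Bin Defs.Sub (Cst 1) (lt_exp row_exp vS)) (lt_exp row_exp link_top_exp))
     (Bin Add
       (Bin Mul (bit_exp 1 col_exp) (eq_exp row_exp (Bin Add vS s)))
       (Bin Mul (Bin Defs.Sub (Cst 1) (bit_exp 1 col_exp)) (eq_exp (Bin Add row_exp vN) (Bin Add vS s))))))
   (Bin Mul (Cst 2) (Bin Mul (bit_exp 2 col_exp)
     (eq_exp row_exp (Bin Add link_top_exp (Bin Div s vN))))).
Definition value_exp : aexp :=
  Bin Add (Bin Mul (lt_exp row_exp vR) entry_exp) (Bin Defs.Sub (Cst 1) (lt_exp row_exp vR)).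

Lemma aval_bit_exp st d e : aval st (bit_exp d e) = odd (aval st e %/ d).
Proof.
rewrite /bit_exp !aval_Bin /= -muln2 divnMA; move: (_ %/ d) => x.
have := odd_double_half x; rewrite divn2; lia.
Qed.

Definition vars (N m k count ptr clauses lits : nat) : seq nat :=
  [:: N; m; ncells N m; nrows N m; k; count; ptr; clauses; lits].

Lemma aval_value_exp N m k count ptr clauses lits g :
  aval (vars N m k count ptr clauses lits, g) value_exp = base_value N m k.
Proof.
set st := (_, g).
have Ecols : aval st cols_exp = ncols N m by [].
have Erow : aval st row_exp = k %/ ncols N m by [].
have Ecol : aval st col_exp = k %% ncols N m.
  rewrite -[LHS]/(k - k %/ ncols N m * ncols N m).
  by rewrite {1}(divn_eq k (ncols N m)) addKn.
have Etop : aval st link_top_exp = ncells N m + m * N by [].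
rewrite /value_exp /entry_exp /base_value.
rewrite !(aval_Bin, aval_eq_exp, aval_lt_exp, aval_bit_exp, Erow, Ecol, Ecols, Etop) /=.
rewrite -/(ncells N m) -/(nrows N m).
move: (k %/ _) (k %% _) => r c; rewrite /base_entry divn1.
case: (r < nrows N m) => /=; rewrite ?mul0n ?mul1n ?addn0 ?add0n //.
congr (_ + _ + _); last by rewrite mulnb.
rewrite [ncells N m <= r]leqNgt; case: (r < ncells N m) => //=.
by case: (odd c); case: (_ < _) => //=; rewrite ?muln0 ?mul0n ?mul1n ?addn0.
Qed.

Definition fill_body : program :=
  Comp (mem9 (Bin Add (Bin Mul (Cst 2) vk) (Cst 2)) (Cst 0))
  (Comp (mem9 (Bin Add (Bin Mul (Cst 2) vk) (Cst 3)) value_exp)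
  (Comp (set9 4 (Bin Add vk (Cst 1))) (set9 5 (Bin Defs.Sub vcount (Cst 1))))).

Definition fill : program := While 5 fill_body.

(* [encode_int] stores the k-th number as sign and absolute value, here at the
   addresses 2k + 2 and 2k + 3. *)
Definition pair_mem (val : nat -> nat) (a : nat) : nat :=
  if odd a then val (a./2.-1) else 0.

Definition filled (val : nat -> nat) (g : nat -> nat) (k c a : nat) : nat :=
  if (2 * k + 2 <= a) && (a < 2 * (k + c) + 2) then pair_mem val a else g a.

Definition put_ones (g : nat -> nat) (s : seq nat) (a : nat) : nat :=
  if a \in [seq 2 * k + 3 | k <- s] then 1 else g a.

Lemma put_ones_cat g s1 s2 : put_ones g (s1 ++ s2) = put_ones (put_ones g s1) s2.
Proof.
by apply: funext => a; rewrite /put_ones map_cat mem_cat; do 2 case: (a \in _).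
Qed.

Lemma put_ones_notin g s a :
  (forall k, k \in s -> a != 2 * k + 3) -> put_ones g s a = g a.
Proof.
move=> H; rewrite /put_ones; case: ifP => // /mapP[k ks E].
by have := H k ks; rewrite E eqxx.
Qed.

Lemma lit_index_ge N m n j (l : 'I_n * bool) : 0 < ncells N m ->
  ncols N m <= lit_index N m j l.
Proof. by move=> S0; rewrite /lit_index; apply: leq_trans (leq_addr _ _); nia. Qed.

(** The scatter loop counts the remaining clauses down, so the current index is recovered by
    subtraction from m. *)
Definition clause_index_exp : aexp := Bin Defs.Sub vm vclauses.
Definition lit_addr_exp : aexp :=
  Bin Add (Bin Mul (Cst 2)
    (Bin Add (Bin Mul (Bin Add link_top_exp clause_index_exp) cols_exp)
      (Bin Add (Bin Add
        (Bin Mul (Cst 4) (Bin Add (Bin Mul clause_index_exp vN) (Mem vptr)))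
        (Cst 2)) (Mem (Bin Add vptr (Cst 1)))))) (Cst 3).

Definition lit_body : program :=
  Comp (mem9 lit_addr_exp (Cst 1))
  (Comp (set9 6 (Bin Add vptr (Cst 2))) (set9 8 (Bin Defs.Sub vlits (Cst 1)))).

Definition clause_body : program :=
  Comp (set9 8 (Mem vptr))
  (Comp (set9 6 (Bin Add vptr (Cst 1)))
  (Comp (While 8 lit_body) (set9 7 (Bin Defs.Sub vclauses (Cst 1))))).

Definition scatter : program := While 7 clause_body.

Lemma size_encode_clause n (c : clause n) : size (encode_clause c) = (2 * size c).+1.
Proof. by rewrite /= size_flatten; congr _.+1; elim: c => //= l c ->; rewrite mulnS. Qed.

Section Run.
Variables V w : nat.
Hypothesis V_ge4 : 4 <= V.
Let V_gt1 : 1 < V. Proof. exact: leq_trans V_ge4. Qed.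

Lemma steps_set9 x e l l' g v : size l = 9 -> bounded V (l, g) ->
    weight e <= w -> vars_lt 9 e -> x < 9 -> aval (l, g) e = v ->
    set_nth 0 l x v = l' ->
  steps V w (set9 x e) (l, g) (cost e + 2) (l', g).
Proof.
move=> l9 Vl we ve x9 <- <-; have := @steps_assign_var V w V_gt1 x e (l, g) Vl we.
by rewrite l9; apply.
Qed.

Lemma steps_mem9 a e l g i v : size l = 9 -> bounded V (l, g) ->
    weight a <= w -> weight e <= w -> vars_lt 9 a -> vars_lt 9 e ->
    aval (l, g) a = i -> aval (l, g) e = v ->
  steps V w (mem9 a e) (l, g) (cost a + (cost e + 1)) (l, update g i v).
Proof.
move=> l9 Vl wa we va ve <- <-; have := @steps_assign_mem V w V_gt1 a e (l, g) Vl wa we.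
by rewrite l9; apply.
Qed.

Lemma bounded_update g i v : (forall a, g a <= V) -> v <= V ->
  forall a, update g i v a <= V.
Proof. by move=> gV vV a; rewrite /update; case: eqP. Qed.

Variables N m : nat.
Hypothesis nrows_le : nrows N m <= V.
Hypothesis N_le : N <= V.

Lemma bounded_vars k count ptr clauses lits g :
    k <= V -> count <= V -> ptr <= V -> clauses <= V -> lits <= V ->
    (forall a, g a <= V) ->
  bounded V (vars N m k count ptr clauses lits, g).
Proof.
move=> *; split=> //=; have := nrows_le; rewrite /nrows; move: (ncells N m) => S Hr.
by rewrite N_le !andbT; repeat (apply/andP; split=> //); move: (m * N) Hr; lia.
Qed.

(** A rounded bound on the weights of all expressions in the two loops, checked below by
    computation. *)
Hypothesis w_ge : 400 <= w.

Lemma steps_fill_body k count ptr clauses lits g :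
    k < V -> count <= V -> ptr <= V -> clauses <= V -> lits <= V ->
    (forall a, g a <= V) ->
  steps V w fill_body (vars N m k count ptr clauses lits, g) 600
    (vars N m k.+1 count.-1 ptr clauses lits,
     update (update g (2 * k + 2) 0) (2 * k + 3) (base_value N m k)).
Proof.
move=> kV cV pV clV lV gV.
have ww e : weight e <= 400 -> weight e <= w by move=> /leq_trans; apply.
have gV1 := bounded_update (2 * k + 2) gV (leq0n V).
have gV2 := bounded_update (2 * k + 3) gV1 (leq_trans (base_value_le N m k) V_ge4).
apply: (@steps_leT _ _ _ _ (_ + (_ + (_ + _)))); last first.
  apply: steps_comp.
    apply: (steps_mem9 (i := 2 * k + 2) (v := 0)) => //; try exact: ww.
    by apply: bounded_vars; rewrite // ltnW.
  apply: steps_comp.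
    apply: (steps_mem9 (i := 2 * k + 3) (v := base_value N m k)) => //;
      try exact: ww; last exact: aval_value_exp.
    by apply: bounded_vars; rewrite // ltnW.
  apply: steps_comp.
    apply: (steps_set9 (v := k.+1) (l' := vars N m k.+1 count ptr clauses lits)) => //;
      try exact: ww; last by rewrite /= addn1.
    by apply: bounded_vars; rewrite // ltnW.
  apply: (steps_set9 (v := count.-1)) => //; try exact: ww; last by rewrite /= subn1.
  by apply: bounded_vars.
by [].
Qed.

Lemma steps_fill k count ptr clauses lits g :
    k + count <= V -> ptr <= V -> clauses <= V -> lits <= V ->
    (forall a, g a <= V) ->
  steps V w fill (vars N m k count ptr clauses lits, g) (count * 601 + 1)
    (vars N m (k + count) 0 ptr clauses lits, filled (base_value N m) g k count).
Proof.
move=> kV pV clV lV gV.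
pose st i : store_state := (vars N m (k + i) (count - i) ptr clauses lits,
                            filled (base_value N m) g k i).
have -> : (vars N m k count ptr clauses lits, g) = st 0.
  rewrite /st addn0 subn0; congr (_, _); apply: funext => a.
  by rewrite /filled addn0; case: ifP => //; lia.
have -> : (vars N m (k + count) 0 ptr clauses lits,
           filled (base_value N m) g k count) = st count by rewrite /st subnn.
apply: steps_while => //.
- by move=> i ic; split=> //=; rewrite subn_eq0 -ltnNge.
- move=> i ic.
  have -> : st i.+1 = (vars N m (k + i).+1 (count - i).-1 ptr clauses lits,
     update (update (filled (base_value N m) g k i) (2 * (k + i) + 2) 0)
        (2 * (k + i) + 3) (base_value N m (k + i))).
    rewrite /st addnS subnS; congr (_, _); apply: funext => a.
    rewrite /filled /update /pair_mem; case: (a =P _) => [->|a3].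
      have -> : (2 * (k + i) + 3)./2.-1 = k + i.
        by lia.
      have -> : odd (2 * (k + i) + 3) by rewrite oddD oddM.
      by case: ifP => //; lia.
    case: (a =P _) => [->|a2].
      have -> : odd (2 * (k + i) + 2) = false by rewrite oddD oddM.
      by case: ifP => //; lia.
    have -> : (2 * k + 2 <= a < 2 * (k + i.+1) + 2) = (2 * k + 2 <= a < 2 * (k + i) + 2).
      by apply/idP/idP; lia.
    by [].
  apply: steps_fill_body => //; try lia.
  move=> a; rewrite /filled /pair_mem; case: ifP => // _; case: ifP => // _.
  exact: leq_trans (base_value_le _ _ _) V_ge4.
- by rewrite /= subnn.
Qed.

Hypothesis cells_gt0 : 0 < ncells N m.
Hypothesis m_le : m <= V.
(** The address of the first number of the second matrix row. *)
Let L := 2 * ncols N m + 2.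
Hypothesis L_le : L <= V.

(** Unread literals lie below [L], while every write goes beyond [L] because literal indices are at
    least [ncols N m]. Hence the loop never destroys input that it still has to read. *)
Lemma steps_lit_loop n j (c : clause n) k count p g :
    j < m -> k <= V -> count <= V -> size c <= V -> p + 2 * size c <= L ->
    (forall a, g a <= V) ->
    (forall i, i < 2 * size c ->
      g (p + i) = nth 0 (flatten [seq [:: nat_of_ord l.1; nat_of_bool l.2] | l <- c]) i) ->
  steps V w (While 8 lit_body) (vars N m k count p (m - j) (size c), g)
    (size c * 201 + 1)
    (vars N m k count (p + 2 * size c) (m - j) 0,
     put_ones g [seq lit_index N m j l | l <- c]).
Proof.
move=> jm kV cV; have ww e : weight e <= 400 -> weight e <= w by move=> /leq_trans; apply.
have mjV : m - j <= V by apply: leq_trans (leq_subr _ _) m_le.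
elim: c p g => [|l c IH] p g szV pL gV gc.
  move: (@steps_while_done V w 8 lit_body (vars N m k count p (m - j) 0, g) erefl isT).
  by rewrite muln0 addn0.
rewrite [size (l :: c)]/= in szV pL gc *; rewrite mulnS in pL gc.
have pV : p <= V by lia.
have g0 : g p = l.1 by rewrite -[p]addn0 gc.
have g1 : g (p + 1) = l.2 by rewrite gc.
pose g' := update g (2 * lit_index N m j l + 3) 1.
have g'V : forall a, g' a <= V by apply: bounded_update => //; lia.
have g'E : g' = put_ones g [:: lit_index N m j l].
  by apply: funext => a; rewrite /g' /update /put_ones /= inE.
have L_idx := lit_index_ge j l cells_gt0.
rewrite mulSn -addnA.
have -> : p + 2 * (size c).+1 = (p + 2) + 2 * size c by lia.
have -> : put_ones g [seq lit_index N m j l0 | l0 <- l :: c] =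
          put_ones g' [seq lit_index N m j l0 | l0 <- c].
  by rewrite g'E -put_ones_cat.
apply: (@steps_while_step _ _ _ _ _ (vars N m k count (p + 2) (m - j) (size c), g')) => //;
  last first.
  apply: IH => //; try lia.
  move=> i ic; rewrite /g' /update; case: eqP => [|_]; first by rewrite /L in pL; lia.
  by rewrite -addnA gc //; lia.
apply: (@steps_leT _ _ _ _ (_ + (_ + _))); last first.
  apply: steps_comp.
    apply: (steps_mem9 (i := 2 * lit_index N m j l + 3) (v := 1)) => //; try exact: ww.
      exact: bounded_vars.
    rewrite /= -/(ncells N m) -/(ncols N m) subKn ?(ltnW jm) // g0 g1.
    by rewrite /lit_index.
  apply: steps_comp.
    apply: (steps_set9 (v := p + 2) (l' := vars N m k count (p + 2) (m - j) (size c).+1)) => //;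
      try exact: ww.
    by apply: bounded_vars => //; lia.
  apply: (steps_set9 (v := size c)) => //; try exact: ww; last by rewrite /= subn1.
  by apply: bounded_vars => //; lia.
by [].
Qed.

Lemma steps_scatter_from n q (F : cnf n) j k count p g :
    is_qcnf q F -> j + size F = m -> k <= V -> count <= V ->
    p + size (flatten [seq encode_clause c | c <- F]) <= L -> (forall a, g a <= V) ->
    (forall i, i < size (flatten [seq encode_clause c | c <- F]) ->
      g (p + i) = nth 0 (flatten [seq encode_clause c | c <- F]) i) ->
  steps V w scatter (vars N m k count p (size F) 0, g)
    (size F * (201 * q + 100).+1 + 1)
    (vars N m k count (p + size (flatten [seq encode_clause c | c <- F])) 0 0,
     put_ones g (lit_indices N m j F)).
Proof.
have ww e : weight e <= 400 -> weight e <= w by move=> /leq_trans; apply.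
move=> qF jm kV cV; elim: F j p g qF jm => [|c F IH] j p g /= qF jm pL gV gF.
  move: (@steps_while_done V w 7 clause_body (vars N m k count p 0 0, g) erefl isT).
  by rewrite addn0.
case/andP: qF => cq qF.
set d := flatten (map _ c) in pL gF *; set e := flatten (map _ F) in IH pL gF *.
have sd : size d = 2 * size c by have [<-] := size_encode_clause c.
rewrite size_cat sd in pL gF.
have g0 : g p = size c by rewrite -[p]addn0 gF.
have jltm : j < m by lia.
have mj : m - j = (size F).+1 by lia.
pose g' := put_ones g [seq lit_index N m j l | l <- c].
have g'V : forall a, g' a <= V.
  by move=> a; rewrite /g' /put_ones; case: ifP => // _; lia.
rewrite mulSn -addnA.
have -> : (p + (size (d ++ e)).+1) = (p + 1 + 2 * size c) + size e by rewrite size_cat; lia.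
rewrite put_ones_cat -/g'.
apply: (@steps_while_step _ _ _ _ _ (vars N m k count (p + 1 + 2 * size c) (size F) 0, g')) => //;
  last first.
  apply: IH => //; try lia.
  move=> i ie; rewrite /g' put_ones_notin.
    have -> : p + 1 + 2 * size c + i = p + (2 * size c + i).+1 by lia.
    rewrite gF; last by lia.
    by rewrite /= nth_cat sd ltnNge leq_addr /= addKn.
  move=> x /mapP[l _ ->]; have := lit_index_ge j l cells_gt0.
  by rewrite /L in pL; lia.
apply: (@steps_leT _ _ _ _ (_ + (_ + ((size c * 201 + 1) + _)))); last first.
  apply: steps_comp.
    apply: (steps_set9 (v := size c)
       (l' := vars N m k count p (size F).+1 (size c))) => //; try exact: ww.
    by apply: bounded_vars => //; lia.
  apply: steps_comp.
    apply: (steps_set9 (v := p + 1)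
       (l' := vars N m k count (p + 1) (size F).+1 (size c))) => //; try exact: ww.
    by apply: bounded_vars => //; lia.
  apply: steps_comp.
    rewrite -mj; apply: steps_lit_loop => //; try lia.
    move=> i ic; rewrite -addnA add1n gF; last by lia.
    by rewrite /= nth_cat sd ic.
  rewrite mj; apply: (steps_set9 (v := size F)) => //; try exact: ww; last by rewrite /= subn1.
  by apply: bounded_vars => //; lia.
by rewrite /=; lia.
Qed.

End Run.

(** * Layout of the output and the complete reduction *)

Lemma lit_indicesP N m n (F : cnf n) k j :
  reflect (exists i l, [/\ i < size F, l \in nth [::] F i & k = lit_index N m (j + i) l])
          (k \in lit_indices N m j F).
Proof.
elim: F j => [|c F IH] j /=; first by right=> -[i [l []]].
rewrite mem_cat; apply: (iffP orP) => [[/mapP[l lc ->]|/IH[i [l [iF li ->]]]]|].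
- by exists 0, l; rewrite addn0.
- by exists i.+1, l; rewrite addnS.
case=> -[|i] [l [iF li Ek]].
- by left; rewrite Ek addn0; apply/mapP; exists l.
- by right; apply/IH; exists i, l; rewrite addSnnS.
Qed.

Lemma lit_index_lt N m n j (l : 'I_n * bool) : n < N -> j < m ->
  lit_index N m j l < nrows N m * ncols N m.
Proof.
move=> nN jm; have lN : l.1 < N by apply: leq_trans nN; rewrite ltnS ltnW.
have lS : j * N + l.1 < ncells N m by rewrite /ncells; nia.
have lc : 4 * (j * N + l.1) + 2 + l.2 < ncols N m.
  by rewrite /ncols; have := leq_b1 l.2; lia.
rewrite /lit_index /nrows; move: (4 * _ + _ + _) lc => c lc.
move: (ncells N m + m * N) (ncols N m) lc => x y; nia.
Qed.

Definition entry (N m n : nat) (F : cnf n) (k : nat) : nat :=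
  if k \in lit_indices N m 0 F then 1 else base_value N m k.

Definition nvalues (N m : nat) : nat := nrows N m * ncols N m + nrows N m.

Definition output (N m n : nat) (F : cnf n) : seq nat :=
  [:: nrows N m; ncols N m]
  ++ flatten [seq [:: 0; entry N m F k] | k <- iota 0 (nvalues N m)].

Lemma size_pairs (f g : nat -> nat) i k :
  size (flatten [seq [:: f j; g j] | j <- iota i k]) = 2 * k.
Proof. by elim: k i => //= k IH i; rewrite IH mulnS. Qed.

Lemma nth_pairs (f g : nat -> nat) i k a : a < 2 * k ->
  nth 0 (flatten [seq [:: f j; g j] | j <- iota i k]) a
  = if odd a then g (i + a./2) else f (i + a./2).
Proof.
elim: k i a => // k IH i [|[|a]] /= ak; rewrite ?addn0 // IH ?negbK; last by lia.
by rewrite addSnnS.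
Qed.

(* The first row of the matrix overlaps the input and is written last. *)
Definition reduction (q : nat) : program :=
  Comp (set9 1 (Mem (Cst 1)))
  (Comp (set9 0 (Bin Add (Mem (Cst 0)) (Cst q.+1)))
  (Comp (set9 2 (Bin Mul (Bin Add vm (Cst 1)) vN))
  (Comp (set9 3 (Bin Add (Bin Add vS (Bin Mul vm vN)) vm))
  (Comp (set9 4 cols_exp)
  (Comp (set9 5 (Bin Defs.Sub (Bin Add (Bin Mul vR cols_exp) vR) vk))
  (Comp fill
  (Comp (set9 6 (Cst 2))
  (Comp (set9 7 vm)
  (Comp scatter
  (Comp (set9 4 (Cst 0))
  (Comp (set9 5 cols_exp)
  (Comp fill
  (Comp (mem9 (Cst 0) vR) (mem9 (Cst 1) cols_exp)))))))))))))).

Lemma le_magnitude s a : nth 0 s a <= magnitude s.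
Proof.
case: (ltnP a (size s)) => sa; last by rewrite nth_default.
apply: leq_trans (leq_addl _ _).
exact: (@leq_bigmax_seq _ s xpredT id _ (mem_nth 0 sa)).
Qed.

Lemma size_encode_cnf_le q n (F : cnf n) : is_qcnf q F ->
  size (flatten [seq encode_clause c | c <- F]) <= size F * (2 * q).+1.
Proof.
elim: F => //= c F IH /andP[cq /IH le]; rewrite size_cat.
by have /= [->] := size_encode_clause c; lia.
Qed.

Lemma steps_reduction q n (F : cnf n) :
    is_qcnf q F -> let N := n + q.+1 in let m := size F in
    let V := magnitude (encode_cnf F) + 4 * nvalues N m + 4 in
  exists st, steps V (q + 400) (reduction q)
     (nseq 9 0, nth 0 (encode_cnf F)) (1202 * nvalues N m + 201 * q.+1 * m + 1000)
     (st, nth 0 (output N m F)) /\ size st = 9.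
Proof.
move=> qF N m V.
have N0 : 0 < N by rewrite /N addnS.
have nN : n < N by rewrite /N; lia.
have S0 : 0 < ncells N m by rewrite muln_gt0 N0.
have V4 : 4 <= V by rewrite leq_addl.
have V1 : 1 < V by exact: leq_trans V4.
(* A clause takes at most 2q + 1 words and N >= q + 1, so the padding makes the encoded clauses fit
   into the first row. *)
have mS : m * (2 * q).+1 <= 2 * ncells N m by rewrite /ncells /N; nia.
have NS : N <= ncells N m by rewrite /ncells; nia.
have mS' : m <= ncells N m by rewrite /ncells; nia.
have SR : ncells N m <= nrows N m by rewrite /nrows -addnA leq_addr.
have nv : nvalues N m = nrows N m * ncols N m + nrows N m by [].
have cv : ncols N m <= nvalues N m by rewrite nv; nia.
have Rv : nrows N m <= nvalues N m by rewrite nv leq_addl.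
have SC : ncols N m = 4 * ncells N m by [].
have vV : 4 * nvalues N m + 4 <= V by rewrite /V; lia.
have RV : nrows N m <= V by lia.
have NV : N <= V by lia.
have mV : m <= V by lia.
have LV : 2 * ncols N m + 2 <= V by lia.
have w4 : 400 <= q + 400 by rewrite leq_addl.
set g0 := nth 0 (encode_cnf F).
have g0V a : g0 a <= V.
  by apply: leq_trans (le_magnitude _ _) _; rewrite /V -addnA leq_addr.
have bound0 l : size l = 9 -> all (fun v => v <= V) l -> bounded V (l, g0) by [].
have len_le : 2 + size (flatten [seq encode_clause c | c <- F]) <= 2 * ncols N m + 2.
  have := size_encode_cnf_le qF; rewrite -/m; lia.
set base := base_value N m.
(* The memory after the three phases: all numbers but the first row are written, the literal
   coefficients are lowered to 1, then the first row is written. *)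
pose g1 := filled base g0 (ncols N m) (nvalues N m - ncols N m).
pose g2 := put_ones g1 (lit_indices N m 0 F).
pose g3 := filled base g2 0 (ncols N m).
have baseV k : base k <= V := leq_trans (base_value_le N m k) V4.
have pairV a : pair_mem base a <= V by rewrite /pair_mem; case: ifP.
have g1V a : g1 a <= V by rewrite /g1 /filled; case: ifP.
have g2V a : g2 a <= V by rewrite /g2 /put_ones; case: ifP => // _; lia.
have g3V a : g3 a <= V by rewrite /g3 /filled; case: ifP.
exists (vars N m (ncols N m) 0
  (2 + size (flatten [seq encode_clause c | c <- F])) 0 0); split; last by [].
(* Addresses are compared by range: the two header words; the first row, which contains no literal
   index; the other numbers; and the rest, where the input has ended too and both sides are 0. *)
have -> : nth 0 (output N m F) = update (update g3 0 (nrows N m)) 1 (ncols N m).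
  apply: funext => -[|[|a]] //; rewrite /update /= /g3 /filled.
  have odd_a : odd a -> a.+2 = 2 * a./2 + 3.
    by move=> oa; have := odd_double_half a; rewrite oa; lia.
  have idx_odd k : (a.+2 == 2 * k + 3) = odd a && (a./2 == k).
    case oa: (odd a); first by rewrite (odd_a oa); lia.
    by apply/negP => /eqP; have := odd_double_half a; rewrite oa; lia.
  have pairE : pair_mem base a.+2 = if odd a then base a./2 else 0.
    by rewrite /pair_mem /= negbK.
  have idxE : (a.+2 \in [seq 2 * k + 3 | k <- lit_indices N m 0 F]) =
              odd a && (a./2 \in lit_indices N m 0 F).
    apply/mapP/andP => [[k kF /eqP]|[oa aF]].
      by rewrite idx_odd => /andP[-> /eqP->].
    by exists a./2; rewrite // (odd_a oa).
  have idx_ge k : k \in lit_indices N m 0 F -> ncols N m <= k < nvalues N m.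
    case/lit_indicesP=> i [l [iF _ ->]]; rewrite lit_index_ge //=.
    by apply: leq_trans (lit_index_lt l nN iF) _; rewrite nv leq_addr.
  have half_lt k : (a < 2 * k) = (a./2 < k) by lia.
  have rangeE lo hi : (2 * lo + 2 <= a.+2 < 2 * hi + 2) = (2 * lo <= a < 2 * hi).
    by lia.
  rewrite rangeE muln0 leq0n add0n [_ && _]/=.
  case: (ltnP a (2 * ncols N m)) => ac.
    rewrite nth_pairs; last by lia.
    rewrite pairE add0n /entry; case: ifP => // _; case: ifP => // /idx_ge.
    by rewrite leqNgt -half_lt ac.
  rewrite /g2 /put_ones idxE /g1 /filled rangeE subnKC // ac [true && _]/=.
  case: (ltnP a (2 * nvalues N m)) => aK.
    by rewrite nth_pairs // add0n /entry pairE; case: (odd a).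
  rewrite nth_default ?size_pairs //.
  case: ifP => [/andP[_ /idx_ge]|_]; first by lia.
  by rewrite /g0 /= nth_default //; lia.
apply: (@steps_leT _ _ _ _ (_ + (_ + (_ + (_ + (_ + (_ + (_ + (_ + (_ + (_ +
  (_ + (_ + (_ + (_ + _))))))))))))))); last first.
  apply: steps_comp.
    by apply: (steps_set9 V4 (v := m) (l' := [:: 0; m; 0; 0; 0; 0; 0; 0; 0]));
      rewrite //=; lia.
  apply: steps_comp.
    by apply: (steps_set9 V4 (v := N) (l' := [:: N; m; 0; 0; 0; 0; 0; 0; 0]));
      rewrite //=; (try apply: bound0); rewrite //= ?mV ?NV //; lia.
  apply: steps_comp.
    apply: (steps_set9 V4 (v := ncells N m) (l' := [:: N; m; ncells N m; 0; 0; 0; 0; 0; 0]));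
      rewrite //=; (try apply: bound0); rewrite //= ?mV ?NV //; try lia.
    by rewrite addn1.
  apply: steps_comp.
    by apply: (steps_set9 V4 (v := nrows N m) (l' := vars N m 0 0 0 0 0));
      rewrite //=; (try apply: bound0); rewrite //= ?mV ?NV ?(leq_trans SR RV) //; lia.
  apply: steps_comp.
    by apply: (steps_set9 V4 (v := ncols N m) (l' := vars N m (ncols N m) 0 0 0 0));
      rewrite //=; (try apply: bounded_vars); rewrite //=; lia.
  apply: steps_comp.
    by apply: (steps_set9 V4 (v := nvalues N m - ncols N m)
        (l' := vars N m (ncols N m) (nvalues N m - ncols N m) 0 0 0));
      rewrite //=; (try apply: bounded_vars); rewrite //=; lia.
  apply: steps_comp.
    by apply: steps_fill => //; lia.
  rewrite subnKC // -/base -/g1.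
  apply: steps_comp.
    by apply: (steps_set9 V4 (v := 2) (l' := vars N m (nvalues N m) 0 2 0 0));
      rewrite //=; (try apply: bounded_vars); rewrite //=; lia.
  apply: steps_comp.
    by apply: (steps_set9 V4 (v := m) (l' := vars N m (nvalues N m) 0 2 m 0));
      rewrite //=; (try apply: bounded_vars); rewrite //=; lia.
  apply: steps_comp.
    apply: (@steps_scatter_from V (q + 400) V4 N m RV NV w4 S0 mV LV n q F 0) => //;
      rewrite ?add0n //; try lia.
    (* The first filling starts beyond the encoded clauses, so they are still intact when they are
       read. *)
    move=> i Hi; rewrite /g1 /filled ifF //; lia.
  rewrite -/g2.
  apply: steps_comp.
    by apply: (steps_set9 V4 (v := 0) (l' := vars N m 0 0
          (2 + size (flatten [seq encode_clause c | c <- F])) 0 0));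
      rewrite //=; (try apply: bounded_vars); rewrite //=; lia.
  apply: steps_comp.
    by apply: (steps_set9 V4 (v := ncols N m) (l' := vars N m 0 (ncols N m)
          (2 + size (flatten [seq encode_clause c | c <- F])) 0 0));
      rewrite //=; (try apply: bounded_vars); rewrite //=; lia.
  apply: steps_comp.
    by apply: steps_fill => //; lia.
  rewrite add0n -/base -/g3.
  apply: steps_comp.
    by apply: (steps_mem9 V4 (i := 0) (v := nrows N m));
      rewrite //=; (try apply: bounded_vars); rewrite //=; lia.
  apply: (steps_mem9 V4 (i := 1) (v := ncols N m)) => //=; try lia.
  by apply: bounded_vars => //; try lia; apply: bounded_update.
rewrite /cost /=; lia.
Qed.

(** * Correctness of the integer program *)

Section Instance.
Variables (N m n : nat) (F : cnf n).

(** The dimensions are put into successor form, as required by [max_entry]; [prednK] undoes this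
    once there is at least one cell. *)
Definition ip_mx : 'M[int]_((nrows N m).-1.+1, (ncols N m).-1.+1) :=
  (\matrix_(i, j) (Posz (entry N m F (i * ncols N m + j))))%R.

Definition ip_rhs : 'cV[int]_((nrows N m).-1.+1) := const_mx 1%R.

Lemma map_enum_ord (T : Type) (f : nat -> T) k :
  [seq f (nat_of_ord i) | i <- enum 'I_k] = [seq f i | i <- iota 0 k].
Proof. by rewrite -val_enum_ord -map_comp. Qed.

Lemma flatten_map_pairs (v : nat -> nat) a k :
  flatten [seq [:: 0; v (a + j)] | j <- iota 0 k]
  = flatten [seq [:: 0; v j] | j <- iota a k].
Proof.
by rewrite -[a in RHS]addn0 iotaDl -map_comp.
Qed.

Hypothesis cells_gt0 : 0 < ncells N m.

Lemma ncols_gt0 : 0 < ncols N m. Proof. by rewrite muln_gt0. Qed.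

Lemma nrows_gt0 : 0 < nrows N m.
Proof. by rewrite /nrows; lia. Qed.

(** The positions after the matrix are those of the right-hand sides, so one formula describes the
    whole output. *)
Lemma entry_ge k : nrows N m * ncols N m <= k -> entry N m F k = 1.
Proof.
move=> kR; rewrite /entry /base_value; case: ifP => // _.
by rewrite ltnNge leq_divRL ?ncols_gt0 // kR.
Qed.

Lemma encode_ip_mx : encode_ip ip_mx ip_rhs = output N m F.
Proof.
rewrite /encode_ip.
have -> : [seq flatten [seq encode_int (ip_mx i j) | j <- enum 'I_(ncols N m).-1.+1]
              | i <- enum 'I_(nrows N m).-1.+1]
  = [seq flatten [seq [:: 0; entry N m F j] | j <- iota (i * ncols N m) (ncols N m)]
       | i <- iota 0 (nrows N m)].
  rewrite -[in RHS](prednK nrows_gt0) -map_enum_ord; apply: eq_map => i.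
  rewrite -flatten_map_pairs -[X in iota 0 X](prednK ncols_gt0) -map_enum_ord.
  by congr flatten; apply: eq_map => j; rewrite mxE.
have -> : [seq encode_int (ip_rhs i 0%R) | i <- enum 'I_(nrows N m).-1.+1]
    = [seq [:: 0; 1] | i <- iota (nrows N m * ncols N m) (nrows N m)].
  rewrite -[nrows N m * ncols N m]addn0 iotaDl -map_comp -[in RHS](prednK nrows_gt0).
  by rewrite -map_enum_ord; apply: eq_map => i; rewrite mxE.
rewrite (prednK ncols_gt0) (prednK nrows_gt0) /output /nvalues iotaD.
rewrite map_cat flatten_cat; congr (_ ++ (_ ++ _)).
  elim: (nrows N m) => // r IH.
  rewrite -addn1 iotaD map_cat flatten_cat IH mulnDl iotaD map_cat flatten_cat.
  by rewrite /= cats0 add0n mul1n.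
rewrite add0n; congr flatten; apply/eq_in_map => k; rewrite mem_iota => /andP[kR _].
by rewrite entry_ge.
Qed.

Definition row_sum (x : nat -> nat) (r : nat) : nat :=
  \sum_(c < ncols N m) entry N m F (r * ncols N m + c) * x c.

(** Moves the system from non-negative integer vectors to functions on [nat], where the row
    equations become plain counting. *)
Lemma ip_feasibleP : ip_feasible ip_mx ip_rhs <->
  exists x : nat -> nat, forall r, r < nrows N m -> row_sum x r = 1.
Proof.
have sumE (x : nat -> nat) r : row_sum x r =
    \sum_(c < (ncols N m).-1.+1) entry N m F (r * ncols N m + c) * x c.
  pose f c := entry N m F (r * ncols N m + c) * x c.
  by rewrite /row_sum -(big_mkord xpredT f) -(big_mkord xpredT f) prednK ?ncols_gt0.
split=> [[x x0 Ax]|[x Hx]].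
  exists (fun c => `|x (inord c) 0%R|%N) => r rR.
  have rR' : r < (nrows N m).-1.+1 by rewrite prednK ?nrows_gt0.
  have := congr1 (fun M : 'cV[int]_ _ => M (Ordinal rR') 0%R) Ax.
  rewrite !mxE sumE => E; apply/eqP; rewrite -eqz_nat -[X in _ == X]E; apply/eqP.
  rewrite -natz natr_sum; apply: eq_bigr => c _.
  by rewrite mxE inord_val natrM !natz gez0_abs.
exists (\col_c Posz (x c))%R => [j|]; first by rewrite mxE.
apply/matrixP => r j; rewrite !mxE.
have rR : r < nrows N m by rewrite -[X in _ < X](prednK nrows_gt0).
have := congr1 Posz (Hx r rR); rewrite sumE => E; rewrite -[RHS]/(Posz 1) -E.
rewrite -[RHS]natz natr_sum; apply: eq_bigr => c _.
by rewrite !mxE natrM !natz.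
Qed.
End Instance.

(** * Evaluating the rows; equivalence with satisfiability *)

Lemma sum_blocks4 (f : nat -> nat) k :
  \sum_(c < 4 * k) f c =
  \sum_(s < k) (f (4 * s) + f (4 * s + 1) + f (4 * s + 2) + f (4 * s + 3)).
Proof.
elim: k => [|k IH]; first by rewrite muln0 !big_ord0.
rewrite [RHS]big_ord_recr -IH /= -!(big_mkord xpredT f) (_ : 4 * k.+1 = (4 * k).+4); last by lia.
by rewrite !big_nat_recr //= !addnA !addn1 addn2 addn3.
Qed.

Lemma sum_indicator (g : nat -> nat) k s : s < k -> \sum_(i < k) (s == i) * g i = g s.
Proof.
move=> sk; rewrite (bigD1 (Ordinal sk)) //= eqxx mul1n big1 ?addn0 // => i ne.
by rewrite (_ : (s == i) = false) //; apply: contraNF ne => /eqP E; apply/eqP/val_inj.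
Qed.

Lemma block4E s a : a < 4 ->
  ((4 * s + a) %/ 4 = s) * (odd (4 * s + a) = odd a) * (odd ((4 * s + a) %/ 2) = odd (a %/ 2)).
Proof.
move=> a4; split; first split.
- by rewrite mulnC divnMDl // divn_small ?addn0.
- by rewrite oddD oddM.
- have -> : 4 * s + a = (2 * s) * 2 + a by lia.
  by rewrite divnMDl // oddD oddM.
Qed.

Section Rows.
Variables (N m n : nat) (F : cnf n).
Hypothesis n_lt : n < N.
Let S := ncells N m.
Let R := nrows N m.

Let N_gt0 : 0 < N. Proof. by lia. Qed.
Let S_gt0 : 0 < S. Proof. by rewrite muln_gt0. Qed.
Let C_gt0 : 0 < ncols N m. Proof. by rewrite muln_gt0. Qed.
Let SE : S = m * N + N. Proof. by rewrite /S /ncells mulSn addnC. Qed.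
Let RE : R = S + m * N + m. Proof. by []. Qed.

Lemma lit_cell_lt j (l : 'I_n * bool) : j < m -> 4 * (j * N + l.1) + 2 + l.2 < ncols N m.
Proof.
move=> jm; have lN : l.1 < N by apply: leq_trans n_lt; rewrite ltnS ltnW.
have lS : j * N + l.1 < ncells N m by rewrite /ncells; nia.
by rewrite /ncols; have := leq_b1 l.2; lia.
Qed.

Lemma cell_lt c : c < ncols N m -> c %/ 4 < S.
Proof. by move=> cC; rewrite ltn_divLR // mulnC. Qed.

Hypothesis size_F : size F = m.

(** The column part of a literal index is below [ncols N m], so division with remainder recovers row
    and column from the flattened position. *)
Lemma entryE r c : r < R -> c < ncols N m ->
  entry N m F (r * ncols N m + c) =
  if [exists j : 'I_m, (r == S + m * N + j) &&
        has (fun l : 'I_n * bool => c == 4 * (j * N + l.1) + 2 + l.2) (nth [::] F j)]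
  then 1 else base_entry N m r c.
Proof.
move=> rR cC; rewrite /entry /base_value divnMDl // divn_small // addn0 rR.
rewrite modnMDl modn_small //; congr (if _ then _ else _).
apply/lit_indicesP/existsP => [[i [l [iF lF]]]|[j /andP[/eqP-> /hasP[l lF /eqP->]]]].
  rewrite size_F in iF; rewrite add0n /lit_index => E.
  have := congr1 (fun k => k %/ ncols N m) E; have := congr1 (fun k => k %% ncols N m) E.
  rewrite !divnMDl // !modnMDl !modn_small ?lit_cell_lt // !divn_small ?lit_cell_lt // !addn0.
  move=> Ec Er; exists (Ordinal iF); rewrite Er eqxx /=; apply/hasP; exists l => //.
  exact/eqP.
by exists j, l; rewrite size_F ltn_ord.
Qed.

Lemma row_sum_cell x s : s < S ->
  row_sum N m F x s = x (4 * s) + x (4 * s + 1) + x (4 * s + 2) + x (4 * s + 3).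
Proof.
move=> sS; pose g i := x (4 * i) + x (4 * i + 1) + x (4 * i + 2) + x (4 * i + 3).
rewrite -/(g s) -(sum_indicator g sS).
have -> : row_sum N m F x s = \sum_(c < 4 * S) (s == c %/ 4) * x c.
  apply: eq_bigr => c _; rewrite entryE //; last by rewrite RE; lia.
  rewrite ifF; last by apply/negbTE/existsPn => j; rewrite negb_and (_ : s == _ = false) //; lia.
  rewrite /base_entry -/S.
  have -> : (s == S + m * N + c %/ 4 %/ N) = false.
    by move: (_ %/ N) => d; lia.
  by rewrite leqNgt sS /= andbF muln0 !addn0.
rewrite (sum_blocks4 (fun c => (s == c %/ 4) * x c)); apply: eq_bigr => i _.
by rewrite !block4E // mulKn // !mulnDr.
Qed.

(** The columns of value 1 in cell s, and those of value 0 in the cell of the same variable one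
    layer later. With the cell rows, total 1 means that both cells have equal value. *)
Lemma row_sum_link x s : s < m * N ->
  row_sum N m F x (S + s) =
  x (4 * s + 1) + x (4 * s + 3) + (x (4 * (s + N)) + x (4 * (s + N) + 2)).
Proof.
move=> sm.
pose g i := x (4 * i + 1) + x (4 * i + 3); pose h i := x (4 * i) + x (4 * i + 2).
have s1 : s < S by lia.
have s2 : s + N < S by lia.
rewrite -/(g s) -/(h _) -(sum_indicator g s1) -(sum_indicator h s2) -big_split /=.
have -> : row_sum N m F x (S + s) =
    \sum_(c < 4 * S) (if odd c then s == c %/ 4 else s + N == c %/ 4) * x c.
  apply: eq_bigr => c _; rewrite entryE //; last by rewrite RE; lia.
  rewrite ifF; last by apply/negbTE/existsPn => j; rewrite negb_and (_ : S + s == _ = false) //; lia.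
  rewrite /base_entry -/S leq_addr ltn_add2l sm /=.
  rewrite -(addnA S s N) -(addnA S (m * N)) !eqn_add2l.
  have : c %/ 4 < S := cell_lt (ltn_ord c); set d := c %/ 4 => dS.
  rewrite (_ : S + s == d = false); last by lia.
  by rewrite (_ : (s == m * N + d %/ N) = false) ?andbF ?muln0 ?addn0 //;
    move: (d %/ N); lia.
pose f c := (if odd c then s == c %/ 4 else s + N == c %/ 4) * x c.
rewrite (sum_blocks4 f) /f; apply: eq_bigr => i _.
rewrite !block4E // mulKn // oddM /= !mulnDr; lia.
Qed.

Lemma entry_clause j c : j < m -> c < ncols N m ->
  entry N m F ((S + m * N + j) * ncols N m + c) =
  if has (fun l : 'I_n * bool => c == 4 * (j * N + l.1) + 2 + l.2) (nth [::] F j) then 1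
  else 2 * (odd (c %/ 2) && (j == c %/ 4 %/ N)).
Proof.
move=> jm cC; rewrite entryE //; last by rewrite RE; lia.
have -> : [exists i : 'I_m, (S + m * N + j == S + m * N + i) &&
        has (fun l : 'I_n * bool => c == 4 * (i * N + l.1) + 2 + l.2) (nth [::] F i)]
    = has (fun l : 'I_n * bool => c == 4 * (j * N + l.1) + 2 + l.2) (nth [::] F j).
  apply/existsP/idP => [[i]|H]; last by exists (Ordinal jm); rewrite /= eqxx.
  by rewrite eqn_add2l => /andP[/eqP->].
rewrite /base_entry -/S eqn_add2l (_ : _ < S + m * N = false); last by lia.
by rewrite andbF (_ : S + m * N + j == c %/ 4 = false) //; have := cell_lt cC; lia.
Qed.

End Rows.

Lemma satisfiable_of_row_sums N n (F : cnf n) (x : nat -> nat) : n < N ->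
    (forall r, r < nrows N (size F) -> row_sum N (size F) F x r = 1) ->
  satisfiable F.
Proof.
move=> nN Hx; set m := size F in Hx.
have cell s : s < m * N + N -> x (4 * s) + x (4 * s + 1) + x (4 * s + 2) + x (4 * s + 3) = 1.
  move=> sS; rewrite -(row_sum_cell nN (erefl m)) ?Hx // /nrows /ncells; lia.
have link s : s < m * N ->
    x (4 * s + 1) + x (4 * s + 3) + (x (4 * (s + N)) + x (4 * (s + N) + 2)) = 1.
  by move=> sm; rewrite -(row_sum_link nN (erefl m)) ?Hx // /nrows; lia.
pose val s := x (4 * s + 1) + x (4 * s + 3).
(* The cell row of s + N turns its value-0 part into 1 - [val (s + N)], and the link row then gives
   [val s = val (s + N)]. *)
have val_layer j i : j <= m -> i < N -> val (j * N + i) = val i.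
  elim: j => [|j IH] jm iN //; rewrite -(IH (ltnW jm) iN) mulSn /val.
  have sm : j * N + i < m * N by nia.
  have := link _ sm; have := @cell (j * N + i + N).
  rewrite (_ : N + j * N + i = j * N + i + N); last by lia.
  lia.
exists (fun i => val i == 1); apply/(all_nthP [::]) => j jm.
have {}jm : j < m := jm.
have rR : ncells N m + m * N + j < nrows N m by rewrite /nrows; lia.
have := Hx _ rR; rewrite /row_sum => E.
(* The clause row has sum 1, so some term is nonzero. A coefficient 2 would make that term at least
   2; hence the column belongs to a literal of the clause. *)
have [c c0] : exists c : 'I_(ncols N m),
    entry N m F ((ncells N m + m * N + j) * ncols N m + c) * x c != 0.
  apply/existsP; apply: contraT => /existsPn H.
  by move: E; rewrite big1 // => c _; apply/eqP; rewrite -[_ == _]negbK.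
move: E c0; rewrite (bigD1 c) //=; move: (bigop _ _ _) => rest.
rewrite entry_clause //; case: ifP => [/hasP[l lF /eqP Ec]|_]; last first.
  by rewrite -mulnA; move: (_ * x c); lia.
rewrite Ec mul1n => E c0; have xc : x (4 * (j * N + l.1) + 2 + l.2) = 1.
  by move: E c0; move: (x _) => y; lia.
apply/hasP; exists l => //.
have lN : l.1 < N by apply: leq_trans nN; rewrite ltnS ltnW.
have jlN : j * N + l.1 < m * N + N by nia.
(* The chosen marked column is the only one used in its cell, so the value of the cell is the sign
   of the literal. *)
rewrite -(val_layer j l.1 (ltnW jm) lN) /val.
have := cell _ jlN; move: xc; case: (l.2) => /=; rewrite ?addn0 -?addnA /=;
  move: (4 * (j * N + l.1)) => d; rewrite ?(addnC 2); lia.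
Qed.

Lemma row_sums_of_satisfiable N n (F : cnf n) : n < N -> satisfiable F ->
  exists x, forall r, r < nrows N (size F) -> row_sum N (size F) F x r = 1.
Proof.
move=> nN [v /allP vF]; set m := size F.
have N0 : 0 < N by lia.
pose val i := if insub i is Some i' then v i' else false.
have valE (i : 'I_n) : val i = v i by rewrite /val valK.
(* The variable of a true literal of clause j. The bound on j is put inside so that the choice is a
   total function. *)
have wit_ex (j : nat) : exists i : nat, j < m ->
    exists2 l, l \in nth [::] F j & v l.1 = l.2 /\ i = l.1.
  case: (ltnP j m) => [jm|mj]; last by exists 0.
  have /vF/hasP[l lF /eqP vl] := mem_nth [::] jm.
  by exists l.1 => _; exists l.
have [wit witP] := boolp.choice wit_ex.
have witN j : j < m -> wit j < N.
  by move=> /witP[l _ [_ ->]]; apply: leq_trans nN; rewrite ltnS ltnW.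
(* The mark of cell s: its variable is the witness of its layer. The last layer, m, has no clause
   and stays unmarked. *)
pose w s := (s %/ N < m) && (s %% N == wit (s %/ N)).
pose x c := (odd c == val (c %/ 4 %% N)) && (odd (c %/ 2) == w (c %/ 4)) : nat.
have x4 s a : a < 4 ->
    x (4 * s + a) = (odd a == val (s %% N)) && (odd (a %/ 2) == w s) :> nat.
  by move=> a4; rewrite /x !block4E.
have x40 s : x (4 * s) = (false == val (s %% N)) && (false == w s) :> nat.
  by rewrite -[4 * s]addn0 x4.
exists x => r rR.
have [rS|rS] := ltnP r (ncells N m).
  rewrite row_sum_cell // !x4 // x40 /=.
  by case: (val _); case: (w _).
have [rT|rT] := ltnP r (ncells N m + m * N).
  rewrite -(subnKC rS) row_sum_link //; last by lia.
  rewrite !x4 // x40 modnDr /=.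
  by case: (val _); do 2 case: (w _).
pose j := r - (ncells N m + m * N).
have jm : j < m by move: rR; rewrite /j /nrows; lia.
have Er : r = ncells N m + m * N + j by rewrite subnKC.
have [l lF [vl wl]] := witP j jm.
have cC := lit_cell_lt nN l jm.
have lN : l.1 < N := ltn_trans (ltn_ord l.1) nN.
set c := _ + _ in cC; rewrite /row_sum Er (bigD1 (Ordinal cC)) //= big1 => [|d dc].
  rewrite addn0 entry_clause // ifT; last by apply/hasP; exists l.
  rewrite /c -addnA x4; last by case: (l.2).
  rewrite modnMDl modn_small // valE vl /w divnMDl // (divn_small lN) addn0.
  by rewrite modnMDl modn_small // jm wl eqxx; case: (l.2).
(* A further column with nonzero coefficient is a marked one of layer j. If [x] used it, its
   variable would be the witness and its value the assigned one, which makes it the column [c]. *)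
apply/eqP; rewrite muln_eq0 -implyNb; apply/implyP => e0.
have dE : (odd (d %/ 2)) && (d %/ 4 %/ N == j).
  move: e0; rewrite entry_clause //; case: ifP => [/hasP[l' _ /eqP ->]|_].
    have l'N : l'.1 < N := ltn_trans (ltn_ord l'.1) nN.
    rewrite -addnA !block4E; [|by case: (l'.2)..].
    by rewrite divnMDl // (divn_small l'N) addn0 eqxx andbT; case: (l'.2).
  by rewrite (eq_sym j); case: (_ && _).
case/andP: dE => dw /eqP dj.
rewrite /x /w dw dj jm /= eqb0; apply: contra dc => /andP[/eqP dval].
move=> /eqP/esym/eqP dwit.
apply/eqP/val_inj; rewrite /= /c.
have := divn_eq (d %/ 4) N; rewrite dj; move: dval; rewrite dwit wl valE vl.
move: (j * N + l.1) => s dval d4; move: dw.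
case: (l.2) dval; move: (nat_of_ord d) d4 => d'; lia.
Qed.

(** * Caterpillar decompositions *)

Lemma connect_ind (T : finType) (e : rel T) (P : pred T) x y :
  (forall v w, e v w -> P v -> P w) -> connect e x y -> P x -> P y.
Proof.
move=> eP /connectP[p]; elim: p x => [|z p IH] x /= => [_ ->//|/andP[xz zp] Ey Px].
exact: IH z zp Ey (eP _ _ xz Px).
Qed.

Section EdgeSide.
Variables (U : finType) (D : branch_decomposition U) (x y : node D) (P : pred (node D)).
Hypotheses (Px : P x) (Py : ~~ P y).
Hypothesis P_edge : forall v w, edge v w -> [set v; w] != [set x; y] -> P v = P w.

(** After the deletion of the edge xy every vertex is still reached from x or from y, and [P], which
    changes only across this edge, tells which. *)
Lemma edge_sideE : edge_side x y = [set u | P (place D u)].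
Proof.
rewrite /edge_side; set cut := (X in connect X).
have cutP v w : connect cut v w -> P v = P w.
  move=> vw; apply/esym/eqP; move: (eqxx (P v)).
  apply: (connect_ind (P := fun z => P z == P v)) vw => a b /andP[ab ne].
  by rewrite (P_edge ab ne).
have [_ _ conn _] := edge_tree D.
have reach w : connect cut x w || connect cut y w.
  have : connect cut x x || connect cut y x by rewrite connect0.
  apply: (connect_ind (P := fun z => connect cut x z || connect cut y z)) (conn x w) => a b ab.
  have [E|ne] := eqVneq [set a; b] [set x; y].
    have : b \in [set x; y] by rewrite -E !inE eqxx orbT.
    by rewrite !inE => /orP[]/eqP->; rewrite connect0 ?orbT.
  have cab : connect cut a b by apply: connect1; rewrite /cut /= ab.
  by case/orP => H; rewrite (connect_trans H cab) ?orbT.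
apply/setP => u; rewrite !inE; apply/idP/idP => [/cutP <-//|Pu].
case/orP: (reach (place D u)) => // /cutP E.
by rewrite -E (negbTE Py) in Pu.
Qed.

End EdgeSide.

(* Spine 0, 1, 3, 5, ..., 2k + 1, with the leaf 2j attached to 2j - 1. *)
Section Caterpillar.
Variable k : nat.
Let V : finType := 'I_(2 * k + 2).

(** By truncated subtraction spine vertex 1 has parent 0. Each positive vertex has exactly one
    smaller neighbour, from which the tree properties follow. *)
Definition parent (v : nat) : nat := if odd v then v - 2 else v.-1.

Definition caterpillar_edge : rel V := fun u v =>
  (u < v) && (u == parent v :> nat) || (v < u) && (v == parent u :> nat).

Lemma parent_lt v : 0 < v -> parent v < v.
Proof. by rewrite /parent; case: ifP; lia. Qed.

Lemma caterpillar_sym : symmetric caterpillar_edge.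
Proof. by move=> u v; rewrite /caterpillar_edge orbC. Qed.

Lemma caterpillar_irr : irreflexive caterpillar_edge.
Proof. by move=> u; rewrite /caterpillar_edge ltnn. Qed.

Lemma caterpillar_connect u v : connect caterpillar_edge u v.
Proof.
have V0 : 0 < 2 * k + 2 by rewrite addnS.
have root m (Hm : m < 2 * k + 2) : connect caterpillar_edge (Ordinal Hm) (Ordinal V0).
  elim/ltn_ind: m Hm => m IH Hm; have [m0|m0] := posnP m.
    by rewrite (_ : Ordinal Hm = Ordinal V0) //; apply: val_inj.
  have pm := parent_lt m0; apply: connect_trans (IH _ pm (ltn_trans pm Hm)).
  by apply: connect1; rewrite /caterpillar_edge /= pm eqxx orbT.
have root' w : connect caterpillar_edge w (Ordinal V0) by case: w.
apply: connect_trans (root' u) _; rewrite (sym_connect_sym caterpillar_sym); exact: root'.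
Qed.

(** The largest vertex of a cycle has only its parent as a neighbour on it, so its predecessor and
    successor coincide. *)
Lemma caterpillar_acyclic (c : seq V) : ucycle caterpillar_edge c -> size c <= 2.
Proof.
case: c => // x0 c0; set c := x0 :: c0 => /andP[cyc unq].
have x0c : x0 \in c by rewrite mem_head.
case: (@arg_maxnP _ x0 (mem c) (@nat_of_ord _) x0c) => x xc xmax.
have [i [|y c'] cE] := rot_to xc; first by rewrite -(size_rot i) cE.
have : cycle caterpillar_edge (x :: y :: c') by rewrite -cE rot_cycle.
have : uniq (x :: y :: c') by rewrite -cE rot_uniq.
rewrite -(size_rot i) cE.
have up v : v \in x :: y :: c' -> caterpillar_edge x v -> v = parent x :> nat.
  rewrite -cE mem_rot => vc; have : v <= x by apply: xmax.
  by rewrite /caterpillar_edge; lia.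
case: (lastP c') up => [//|c'' z] up.
rewrite /= rcons_path last_rcons => /and3P[_ yz _] /and3P[xy _ zx].
have Ey := up y _ xy; have Ez := up z _ (etrans (caterpillar_sym x z) zx).
suff E : y = z by rewrite E mem_rcons mem_head in yz.
by apply/val_inj; rewrite /= Ey ?Ez // !inE ?mem_rcons ?mem_head ?eqxx ?orbT.
Qed.

Lemma caterpillar_tree : is_tree caterpillar_edge.
Proof. split; [exact: caterpillar_sym|exact: caterpillar_irr|exact: caterpillar_connect|exact: caterpillar_acyclic]. Qed.

Lemma caterpillar_leaf (v : V) : ~~ odd v -> degree caterpillar_edge v = 1.
Proof.
case: v => v Hv /= ev; have [v0|v0] := posnP v.
  have H1 : 1 < 2 * k + 2 by lia.
  rewrite /degree (_ : [set y | _] = [set Ordinal H1]) ?cards1 //.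
  apply/setP => w; rewrite !inE /caterpillar_edge -val_eqE /= v0 /parent; case ow: (odd w); lia.
have Hp := ltn_trans (parent_lt v0) Hv.
rewrite /degree (_ : [set y | _] = [set Ordinal Hp]) ?cards1 //.
apply/setP => w; rewrite !inE /caterpillar_edge -val_eqE /= {Hp} /parent (negbTE ev).
case ow: (odd w); lia.
Qed.

Lemma caterpillar_cubic : is_cubic caterpillar_edge.
Proof.
move=> v; case ov: (odd v); last by left; apply: caterpillar_leaf; rewrite ov.
case: v ov => v Hv /= ov; have v0 : 0 < v by case: v ov {Hv}.
have Hp := ltn_trans (parent_lt v0) Hv.
have [vk|vk] := eqVneq v (2 * k + 1).
  left; rewrite /degree (_ : [set y | _] = [set Ordinal Hp]) ?cards1 //.
  apply/setP => w; rewrite !inE /caterpillar_edge -val_eqE /= {Hp} /parent ov.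
  by have := ltn_ord w; case ow: (odd w); lia.
have H1 : v.+1 < 2 * k + 2 by lia.
have H2 : v.+2 < 2 * k + 2 by lia.
right; rewrite /degree (_ : [set y | _] = Ordinal Hp |: [set Ordinal H1; Ordinal H2]).
  by rewrite cardsU1 cards2 !inE -!val_eqE /= /parent ov; lia.
apply/setP => w; rewrite !inE /caterpillar_edge -!val_eqE /= {Hp} /parent ov.
case ow: (odd w); lia.
Qed.

Lemma caterpillar_edge_caterpillar : is_caterpillar caterpillar_edge.
Proof.
have V0 : 0 < 2 * k + 2 by rewrite addnS.
pose z := Ordinal V0; pose f i : V := insubd z (2 * i + 1).
have fE i : i <= k -> f i = 2 * i + 1 :> nat.
  by move=> ik; rewrite val_insubd ifT //; lia.
have mem_odd (v : V) : odd v -> v \in [seq f i | i <- iota 0 k.+1].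
  move=> ov; apply/mapP; have Hv := ltn_ord v; exists v./2; first by rewrite mem_iota; lia.
  by apply/val_inj; rewrite /= fE; lia.
exists z, [seq f i | i <- iota 0 k.+1]; split.
- apply/(pathP z) => i; rewrite size_map size_iota => ik.
  have nthE j : j <= k -> nth z [seq f i | i <- iota 0 k.+1] j = f j.
    by move=> jk; rewrite (nth_map 0) ?size_iota // nth_iota.
  rewrite nthE // /caterpillar_edge fE //.
  case: i ik => [|i] ik; first by rewrite [nth _ _ _]/=.
  rewrite -[nth z (z :: _) i.+1]/(nth z [seq f j | j <- iota 0 k.+1] i) nthE ?fE; [|lia..].
  by rewrite /parent oddD oddM /=; lia.
- rewrite cons_uniq map_inj_in_uniq ?iota_uniq ?andbT.
    apply/mapP => -[i]; rewrite mem_iota => Hi /(congr1 val) /=.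
    by rewrite fE; lia.
  move=> i j; rewrite !mem_iota => Hi Hj /(congr1 val) /=; rewrite !fE; lia.
move=> v; rewrite inE negb_or => /andP[vz nv].
have ev : ~~ odd v by apply: contra nv; exact: mem_odd.
split; first exact: caterpillar_leaf.
have v0 : 0 < v by rewrite lt0n; apply: contra vz => /eqP E; apply/eqP/val_inj.
have Hp := ltn_trans (parent_lt v0) (ltn_ord v).
exists (Ordinal Hp); last by rewrite caterpillar_sym /caterpillar_edge /= parent_lt ?eqxx.
rewrite inE mem_odd ?orbT //= /parent (negbTE ev); lia.
Qed.

(** The elements sit on the hanging leaves in their natural order; the two end leaves 0 and 2k + 1
    stay empty. *)
Definition caterpillar_place (u : 'I_k) : V := insubd (Ordinal (ltn_addl (2 * k) (ltn0Sn 1))) (2 * u + 2).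

Lemma caterpillar_placeE u : caterpillar_place u = 2 * u + 2 :> nat.
Proof. by rewrite val_insubd ifT //; have := ltn_ord u; lia. Qed.

Lemma caterpillar_place_inj : injective caterpillar_place.
Proof. by move=> u v /(congr1 val) /=; rewrite !caterpillar_placeE => E; apply/val_inj => /=; lia. Qed.

Lemma caterpillar_place_leaf u : degree caterpillar_edge (caterpillar_place u) = 1.
Proof. by apply: caterpillar_leaf; rewrite caterpillar_placeE oddD oddM. Qed.

Definition caterpillar_decomposition : branch_decomposition 'I_k :=
  BranchDecomposition caterpillar_tree caterpillar_cubic caterpillar_place_inj caterpillar_place_leaf.

(** For odd x this is a spine edge, cutting off all vertices from x on; for even x it cuts off a
    single leaf. *)
Lemma caterpillar_edge_side (x y : V) : y = parent x :> nat -> 0 < x ->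
  let X := if odd x then [set u : 'I_k | x <= 2 * u + 2]
           else [set u : 'I_k | 2 * u + 2 == x] in
  @edge_side _ caterpillar_decomposition x y = X /\
  @edge_side _ caterpillar_decomposition y x = ~: X.
Proof.
move=> Ey x0.
pose P (v : V) := if odd x then x <= v else v == x.
have Px : P x by rewrite /P leqnn eqxx if_same.
have yx := parent_lt x0; rewrite -Ey in yx.
have Py : ~~ P y by rewrite /P -val_eqE /=; case: ifP => _; lia.
have P_edge v w : caterpillar_edge v w -> [set v; w] != [set x; y] -> P v = P w.
  wlog vw : v w / v < w.
    move=> H vw ne; have [lt|ge] := ltnP v w; first exact: H.
    apply/esym; apply: H; rewrite 1?caterpillar_sym 1?finset.setUC //.
    by move: vw; rewrite /caterpillar_edge; lia.
  rewrite /caterpillar_edge vw ltnNge (ltnW vw) /= orbF => /eqP Ev ne.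
  have wx : w != x.
    apply: contra ne => /eqP E; rewrite E finset.setUC (_ : v = y) //.
    by apply/val_inj; rewrite /= Ev Ey E.
  rewrite -val_eqE /= in wx; rewrite /P -!val_eqE /=; move: Ev; rewrite /parent.
  by case ow: (odd w) => Ev; case ox: (odd x); lia.
move=> X.
have -> : X = [set u | P (caterpillar_place u)].
  rewrite /X /P; case: (odd x); apply/setP => u; rewrite !inE.
    by rewrite -[x <= caterpillar_place u]/(x <= val (caterpillar_place u)) /= caterpillar_placeE.
  by rewrite -val_eqE /= caterpillar_placeE.
split; first exact: (@edge_sideE _ caterpillar_decomposition x y P).
rewrite (@edge_sideE _ caterpillar_decomposition y x (predC P)) //=.
- by apply/setP => u; rewrite !inE.
- by rewrite Px.
- by move=> v w vw; rewrite (finset.setUC [set y]) => ne; congr (~~ _); apply: P_edge.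
Qed.

End Caterpillar.

(** * Path-width from the cuts of a linear order *)

Lemma rank_le_card (U : finType) (indep : pred {set U}) (X : {set U}) :
  matroid_rank indep X <= #|X|.
Proof. by apply/bigmax_leqP => Y /andP[/subset_leq_card]. Qed.

Lemma rank_subset (U : finType) (indep : pred {set U}) (X Y : {set U}) :
  X \subset Y -> matroid_rank indep X <= matroid_rank indep Y.
Proof.
move=> XY; apply/bigmax_leqP => Z /andP[ZX iZ].
by apply: (@leq_bigmax_cond _ _ (fun Z : {set U} => #|Z|)); rewrite iZ (fintype.subset_trans ZX).
Qed.

Lemma connectivityC (U : finType) (indep : pred {set U}) (X : {set U}) :
  connectivity indep (~: X) = connectivity indep X.
Proof. by rewrite /connectivity finset.setCK (addnC (matroid_rank _ (~: X))). Qed.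

Lemma connectivity_set1 (U : finType) (indep : pred {set U}) (u : U) :
  connectivity indep [set u] <= 2.
Proof.
have := rank_le_card indep [set u]; rewrite cards1 /connectivity.
have := rank_subset indep (finset.subsetT (~: [set u])); lia.
Qed.

(** In the caterpillar on the given order, spine edges induce the prefix cuts, and leaf edges have
    width at most 2. *)
Lemma path_width_le k (indep : pred {set 'I_k}) W : 1 < W ->
    (forall t, connectivity indep [set u : 'I_k | u < t] <= W) ->
  path_width indep <= W.
Proof.
move=> W1 HW; rewrite /path_width; case: ex_minnP => w _ min_w.
apply: leq_trans (min_w (width indep (caterpillar_decomposition k)) _) _.
  by apply/asboolP; exists (caterpillar_decomposition k); first exact: caterpillar_edge_caterpillar.
apply/bigmax_leqP => -[x y] /= xy.
have sideW (a b : 'I_(2 * k + 2)) : b = parent a :> nat -> 0 < a ->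
    connectivity indep (@edge_side _ (caterpillar_decomposition k) a b) <= W /\
    connectivity indep (@edge_side _ (caterpillar_decomposition k) b a) <= W.
  move=> Eb a0; have [-> ->] := caterpillar_edge_side Eb a0; rewrite connectivityC.
  suff : connectivity indep (if odd a then [set u : 'I_k | a <= 2 * u + 2]
           else [set u : 'I_k | 2 * u + 2 == a]) <= W by [].
  case: ifP => oa.
    rewrite -connectivityC (_ : ~: _ = [set u : 'I_k | u < a./2]) //.
    by apply/setP => u; rewrite !inE; lia.
  have ak : a./2.-1 < k by have := ltn_ord a; lia.
  rewrite (_ : [set u | _] = [set Ordinal ak]).
    exact: leq_trans (connectivity_set1 _ _) W1.
  by apply/setP => u; rewrite !inE -val_eqE /=; lia.
case/orP: xy => /andP[lt /eqP E].
  by have [] := sideW y x E (leq_ltn_trans (leq0n _) lt).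
by have [] := sideW x y E (leq_ltn_trans (leq0n _) lt).
Qed.

(** * Connectivity of column matroids *)

Section LinearMatroid.
Variables (K : fieldType) (vT : vectType K) (U : finType) (v : U -> vT).

Let indep : pred {set U} := fun X => free [seq v u | u <- enum X].
Let sp (X : {set U}) : {vspace vT} := <<[seq v u | u <- enum X]>>%VS.

Lemma mem_sp (X : {set U}) u : u \in X -> v u \in sp X.
Proof. by move=> uX; apply/memv_span/mapP; exists u; rewrite ?mem_enum. Qed.

Lemma sp_subP (X : {set U}) (W : {vspace vT}) : (forall u, u \in X -> v u \in W) -> (sp X <= W)%VS.
Proof.
by move=> H; apply/span_subvP => w /mapP[u]; rewrite mem_enum => /H uW ->.
Qed.

(** A largest independent subset spans [sp X], since a vector outside its span could be added to
    it. *)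
Lemma matroid_rank_dim (X : {set U}) : matroid_rank indep X = \dim (sp X).
Proof.
have dimI Y : indep Y -> #|Y| = \dim (sp Y).
  by rewrite /indep /free => /eqP ->; rewrite size_map cardE.
have indep0 : indep finset.set0 by rewrite /indep enum_set0 /= nil_free.
apply/eqP; rewrite eqn_leq; apply/andP; split.
  apply/bigmax_leqP => Y /andP[YX /dimI ->]; apply: dimvS.
  by apply: sp_subP => u uY; apply: mem_sp; apply: (fintype.subsetP YX).
pose ok (Y : {set U}) := (Y \subset X) && indep Y.
have ok0 : ok finset.set0 by rewrite /ok finset.sub0set.
case: (@arg_maxnP _ finset.set0 ok (fun Y : {set U} => #|Y|) ok0) => Y /andP[YX iY] maxY.
apply: (@leq_trans #|Y|); last first.
  by apply: (@leq_bigmax_cond _ _ (fun Z : {set U} => #|Z|)); rewrite YX.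
rewrite (dimI _ iY); apply/dimvS/sp_subP => u uX; apply: contraT => uY.
have uY' : u \notin Y by apply: contra uY; exact: mem_sp.
have : ok (u |: Y).
  rewrite /ok finset.subUset finset.sub1set uX YX /= /indep.
  have /perm_map/perm_free-> : perm_eq (enum (u |: Y)) (u :: enum Y).
    apply: uniq_perm; rewrite /= ?enum_uniq ?mem_enum ?uY' //.
    by move=> z; rewrite !inE !mem_enum !inE.
  by rewrite /= free_cons uY; exact: iY.
by move=> /maxY; rewrite /= cardsU1 uY' add1n ltnn.
Qed.

(** The dimension formula for sum and intersection, as the two sides together span everything. *)
Lemma connectivity_dim (X : {set U}) :
  connectivity indep X = \dim (sp X :&: sp (~: X)) + 1.
Proof.
rewrite /connectivity !matroid_rank_dim; congr (_ + 1).
have -> : sp [set: U] = (sp X + sp (~: X))%VS.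
  apply/eqP; rewrite -[_ == _]/(_ == _ :> {vspace vT}) eqEsubv subv_add; apply/andP; split.
    apply: sp_subP => u _; have [uX|uX] := boolP (u \in X).
      by apply: (subvP (addvSl _ _)); apply: mem_sp.
    by apply: (subvP (addvSr _ _)); apply: mem_sp; rewrite inE.
  by apply/andP; split; apply: sp_subP => u _; apply: mem_sp; rewrite inE.
by rewrite -dimv_sum_cap addKn.
Qed.

End LinearMatroid.

Lemma span_coord0 (K : fieldType) m (s : seq 'cV[K]_m) (r : 'I_m) w :
  w \in span s -> (forall u, u \in s -> u r 0%R = 0%R) -> w r 0%R = 0%R.
Proof.
move=> ws s0; rewrite (coord_span (X := in_tuple s) ws) summxE big1 // => i _.
by rewrite !mxE s0 ?mulr0 // mem_nth.
Qed.

(** A vector in both column spans vanishes in every row that is zero on one side, so it lies in the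
    span of the unit vectors of the rows in [s]. *)
Lemma connectivity_crossing m n (A : 'M[int]_(m, n)) (X : {set 'I_n}) (s : seq 'I_m) :
    (forall r c c', c \in X -> c' \notin X ->
      A r c != 0%R -> A r c' != 0%R -> r \in s) ->
  connectivity (column_matroid A) X <= size s + 1.
Proof.
move=> cross; rewrite connectivity_dim leq_add2r.
set B := map_mx _ A.
pose t : seq 'cV[rat]_m := [seq delta_mx r 0%R | r <- s].
apply: (@leq_trans (\dim (span t))).
  2: by have := dim_span t; rewrite size_map.
apply/dimvS/subvP => w; rewrite memv_cap => /andP[wX wX'].
have -> : w = (\sum_r w r 0 *: delta_mx r 0)%R.
  rewrite {1}[w]matrix_sum_delta; apply: eq_bigr => r _.
  by rewrite big_ord_recl big_ord0 addr0; congr (w r _ *: delta_mx _ _)%R.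
apply: memv_suml => r _; have [rs|rs] := boolP (r \in s).
  by apply/memvZ/memv_span/mapP; exists r.
suff -> : w r 0%R = 0%R by rewrite scale0r mem0v.
have [[c cX Ac]|noX] := pselect (exists2 c, c \in X & A r c != 0%R).
  apply: (span_coord0 wX') => u /mapP[c']; rewrite mem_enum inE => cX' ->.
  rewrite !mxE; have [->//|Ac'] := eqVneq (A r c') 0%R.
  by rewrite (cross r c c') in rs.
apply: (span_coord0 wX) => u /mapP[c]; rewrite mem_enum => cX ->.
rewrite !mxE; have [->//|Ac] := eqVneq (A r c) 0%R.
by case: noX; exists c.
Qed.

(** * Path-width of the constructed matrix *)

(** A superset of the nonzero pattern that forgets value and mark, and thus depends on the cell of
    the column only. *)
Definition entry_support (N m r c : nat) : bool :=
  [|| r == c %/ 4,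
      [&& ncells N m <= r, r < ncells N m + m * N & (r == ncells N m + c %/ 4) || (r + N == ncells N m + c %/ 4)]
    | r == ncells N m + m * N + c %/ 4 %/ N].

Lemma entry_neq0 N m n (F : cnf n) r c : n < N -> size F = m ->
    r < nrows N m -> c < ncols N m ->
  entry N m F (r * ncols N m + c) != 0 -> entry_support N m r c.
Proof.
move=> nN Fm rR cC; rewrite entryE // /entry_support; case: ifP => [/existsP[j]|_].
  case/andP=> /eqP-> /hasP[l _ /eqP->] _.
  have lN : l.1 < N := ltn_trans (ltn_ord l.1) nN.
  rewrite -(addnA (4 * _)) block4E; last by case: (l.2).
  by rewrite divnMDl ?(divn_small lN) ?addn0 ?eqxx ?orbT //; lia.
rewrite /base_entry; case: (r == c %/ 4) => //=.
case: (r == _ + _ + _) => /=; first by rewrite orbT.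
rewrite andbF muln0 addn0 orbF; case: (_ <= r) => //=.
by case: (_ < _) => //=; case: (odd c); do 2 case: (_ == _ + _).
Qed.

Lemma path_width_ip_mx N n (F : cnf n) : n < N ->
  path_width (column_matroid (ip_mx N (size F) F)) <= N + 4.
Proof.
move=> nN; set m := size F; have N0 : 0 < N by lia.
have S0 : 0 < ncells N m by rewrite muln_gt0.
have EC := prednK (ncols_gt0 S0); have ER := prednK (nrows_gt0 S0).
apply: path_width_le => [|t]; first by rewrite addn4.
(* With u the cell at the cut, the crossing rows are among the cell row of u, the clause row of its
   layer and the link rows i with i <= u <= i + N. These are N + 3 rows; numbers out of range become
   row 0 under [inord], which is harmless. *)
pose s := (t %/ 4) :: (ncells N m + m * N + t %/ 4 %/ N)
  :: [seq ncells N m + i | i <- iota (t %/ 4 - N) N.+1].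
have ss : size [seq (inord i : 'I_(nrows N m).-1.+1) | i <- s] + 1 = N + 4.
  by rewrite size_map /= size_map size_iota; lia.
rewrite -ss; apply: connectivity_crossing => r c c'; rewrite [c \in _]inE [c' \in _]inE -leqNgt !mxE => ct tc'.
have rR : r < nrows N m by rewrite -[X in _ < X]ER.
have cC : c < ncols N m by rewrite -[X in _ < X]EC.
have cC' : c' < ncols N m by rewrite -[X in _ < X]EC.
rewrite !eqz_nat => /(entry_neq0 nN (erefl m) rR cC) sc.
move=> /(entry_neq0 nN (erefl m) rR cC') sc'.
suff rs : nat_of_ord r \in s by apply/mapP; exists (nat_of_ord r); rewrite ?inord_val.
have le1 : c %/ 4 <= t %/ 4 by apply: leq_div2r; exact: ltnW.
have le2 : t %/ 4 <= c' %/ 4 by apply: leq_div2r.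
have le3 : c %/ 4 %/ N <= t %/ 4 %/ N by apply: leq_div2r.
have le4 : t %/ 4 %/ N <= c' %/ 4 %/ N by apply: leq_div2r.
have cS : c %/ 4 < ncells N m by rewrite ltn_divLR // mulnC.
have cS' : c' %/ 4 < ncells N m by rewrite ltn_divLR // mulnC.
have SE : ncells N m = m * N + N by rewrite /ncells mulSn addnC.
have cl x : x %/ 4 < ncells N m -> x %/ 4 %/ N <= m.
  by move=> H; rewrite -ltnS ltn_divLR.
rewrite /s 2!in_cons.
move: sc sc'; rewrite /entry_support.
move: (c %/ 4 %/ N) (c' %/ 4 %/ N) (t %/ 4 %/ N) le3 le4 => d d' e.
move: (c %/ 4) (c' %/ 4) (t %/ 4) le1 le2 cS cS' => {ct tc' cC cC' c c'} c c' u.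
move: (ncells N m) rR SE S0 => S rR SE S0 *.
have [rS|rS] := ltnP r S; first by apply/orP; left; lia.
have [rT|rT] := ltnP r (S + m * N); last first.
  by apply/orP; right; apply/orP; left; lia.
apply/orP; right; apply/orP; right; apply/mapP; exists (r - S); last by lia.
by rewrite mem_iota; lia.
Qed.

(** * Running time *)

Lemma decides_leC p C C' s ans t : C <= C' -> decides p C s ans t -> decides p C' s ans t.
Proof.
move=> CC [s' ex ansP]; exists s' => //; apply: exec_leW ex.
by rewrite leq_pexp2l // addn2.
Qed.

Definition sat_program (q : nat) (p : program) : program :=
  Comp (reduction q) (Comp (clear_regs (nregs (reduction q))) p).

Lemma nrows_le_ncells N m : 0 < N -> nrows N m <= 3 * ncells N m.
Proof.
move=> N0; have : m < ncells N m by rewrite -[X in X <= _]muln1 leq_mul.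
by rewrite /nrows /ncells mulSn; lia.
Qed.

Lemma nvalues_le N m : 0 < N -> nvalues N m <= 15 * ncells N m ^ 2.
Proof.
move=> N0; have R3 := nrows_le_ncells m N0.
have S0 : 0 < ncells N m by rewrite muln_gt0 N0.
rewrite /nvalues -mulnSr; apply: (@leq_trans (3 * ncells N m * (5 * ncells N m))).
  by apply: leq_mul => //; rewrite /ncols; lia.
by rewrite expnS expn1; nia.
Qed.

Lemma size_ip_mx_le N m : 0 < N -> nrows N m * ncols N m <= 12 * ncells N m ^ 2.
Proof.
move=> N0; apply: leq_trans (leq_mul (nrows_le_ncells m N0) (leqnn _)) _.
by rewrite /ncols mulnACA mulnn.
Qed.

Lemma reduction_time_le N m q c : 0 < N ->
  1202 * nvalues N m + 201 * q.+1 * m + 1000 + c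
  <= (1202 * 15 + 201 * q.+1 + 1000 + c) * ncells N m ^ 2.
Proof.
move=> N0; have S0 : 0 < ncells N m ^ 2 by rewrite expn_gt0 muln_gt0 N0.
have mS : m <= ncells N m ^ 2.
  apply: (@leq_trans (ncells N m)).
    by apply: ltnW; rewrite -[m.+1]muln1 leq_mul.
  by rewrite -{1}(expn1 (ncells N m)) leq_pexp2l // muln_gt0 N0.
rewrite !mulnDl; apply: leq_add; last exact: leq_pmulr.
apply: leq_add; last exact: leq_pmulr.
apply: leq_add; last by rewrite leq_mul2l mS orbT.
by rewrite -mulnA leq_mul2l nvalues_le ?orbT.
Qed.

Lemma magnitude_output_le N m n (F : cnf n) :
  magnitude (output N m F) <= 3 * nvalues N m + 6.
Proof.
have -> : 3 * nvalues N m + 6 = (2 * nvalues N m).+2 + (nvalues N m + 4) by lia.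
rewrite /magnitude /output size_cat size_pairs add2n leq_add2l.
apply/bigmax_leqP_seq => v; rewrite mem_cat !inE => /orP[/orP[]/eqP->|].
- by move=> _; rewrite /nvalues; lia.
- have : ncells N m <= nrows N m by rewrite /nrows -addnA leq_addr.
  by move=> + _; rewrite /nvalues /ncols; nia.
case/flattenP => s /mapP[k _ ->]; rewrite !inE => /orP[]/eqP-> // _.
apply: leq_trans (leq_addl _ _); rewrite /entry; case: ifP => // _.
exact: base_value_le.
Qed.

(** The word bounds of both phases have bases at most [B ^ (2 * q + 14)], with [B] the base allowed
    for the whole run; the exponents q + 400 and C of the phases are covered by their sum. *)
Lemma sat_programP q p C n (F : cnf n) t (N := n + q.+1) (m := size F) :
    is_qcnf q F ->
    decides p C (encode_ip (ip_mx N m F) (ip_rhs N m))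
      (ip_feasible (ip_mx N m F) (ip_rhs N m)) t ->
  exists2 t', decides (sat_program q p) ((2 * q + 14) * (q + 400 + C)) (encode_cnf F) (satisfiable F) t' &
     t' <= 1202 * nvalues N m + 201 * q.+1 * m + 1000 + (nregs (reduction q)).+1 + t.
Proof.
move=> qF [sf exf ansf].
have N0 : 0 < N by rewrite /N addnS.
have nN : n < N by rewrite /N; lia.
have S0 : 0 < ncells N m by rewrite muln_gt0 N0.
set V := magnitude (encode_cnf F) + 4 * nvalues N m + 4.
have [st [red _]] := steps_reduction qF.
rewrite /sat_program; move: (reduction q) (1202 * _ + _ + _) red => code T red.
have [|t1 [s1 [ex1 le1 [_ ram1]]]] := red (init (encode_cnf F)).
  by split=> // x; rewrite nth_nseq; case: ifP.
have regs1 := exec_reg_ge ex1; move: (nregs code) regs1 => K regs1.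
have ex2 W := @exec_clear_regs W K s1.
(* Low registers are cleared and high ones were never touched, so [p] starts exactly as on its own
   input. *)
have Es2 : State (fun x => if x < maxn K 1 then 0 else reg s1 x) (ram s1) =
    init (encode_ip (ip_mx N m F) (ip_rhs N m)).
  rewrite /init encode_ip_mx // ram1; congr (State _ _); apply: funext => x.
  by case: (ltnP x (maxn K 1)) => // Kx; rewrite regs1 // (leq_trans (leq_maxl _ _) Kx).
rewrite Es2 in ex2.
pose t' := t1 + (K.+1 + t).
have tK : t' <= T + K.+1 + t by rewrite /t' addnA leq_add2r leq_add2r.
exists t' => //; exists sf; last first.
  rewrite ansf ip_feasibleP //; split=> [[x Hx]|].
    exact: (satisfiable_of_row_sums nN Hx).
  exact: row_sums_of_satisfiable.
set B := magnitude (encode_cnf F) + t' + 2.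
have B2 : 1 < B by rewrite /B addn2.
have magB : magnitude (encode_cnf F) + 2 <= B by rewrite /B leq_add2r leq_addr.
have nB : n < B.
  by have nM : n <= _ := le_magnitude (encode_cnf F) 0; lia.
have mB : m.+1 <= B.
  by apply: leq_trans magB; rewrite addn2 ltnS ltnW // ltnS (le_magnitude (encode_cnf F) 1).
(* From n < B and q + 1 <= B ^ q follows N <= B ^ (q + 1); the factor m + 1 costs one more power,
   and squaring doubles the exponent. *)
have SB : ncells N m ^ 2 <= B ^ (2 * q + 4).
  have -> : 2 * q + 4 = (q + 2) * 2 by lia.
  rewrite expnM leq_exp2r // addnC expnD /ncells.
  have NB : N <= B * B ^ q.
    have : q.+1 <= B ^ q by exact: ltn_expl.
    move=> By; apply: leq_trans (leq_mul nB By); rewrite /N; lia.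
  by rewrite expnS expn1 -mulnA leq_mul.
have c64 : 64 <= B ^ 6 by rewrite -[64]/(2 ^ 6) leq_exp2r.
(* The 64 covers 4 * 15 + 4 from [V] and 3 * 15 + 6 from the magnitude of the produced instance. *)
have bound x : x <= 64 * ncells N m ^ 2 + B -> x <= B ^ (2 * q + 14).
  move=> /leq_trans; apply; apply: (@leq_trans (B ^ (2 * q + 10) * B ^ 1)); last first.
    by rewrite -expnD leq_pexp2l // 1?ltnW //; lia.
  have : 64 * ncells N m ^ 2 <= B ^ (2 * q + 10).
    by rewrite -[10]/(6 + 4) addnCA expnD leq_mul.
  have : 1 < B ^ (2 * q + 10) by apply: leq_trans (ltn_expl (2 * q + 10) B2); lia.
  by rewrite expn1; move: (B ^ _) (64 * _) => y z; nia.
have nv := nvalues_le m N0.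
have S1 : 0 < ncells N m ^ 2 by rewrite expn_gt0 S0.
have V_le : V <= B ^ (2 * q + 14) by apply: bound; rewrite /V; lia.
have mag_le : magnitude (encode_ip (ip_mx N m F) (ip_rhs N m)) + t + 2 <= B ^ (2 * q + 14).
  apply: bound; rewrite encode_ip_mx //; have := magnitude_output_le N m F.
  have : t + 2 <= B by rewrite /B /t'; lia.
  lia.
have B0 : 0 < B by rewrite /B addn2.
have W_le k (x : nat) : k <= q + 400 + C -> x <= B ^ (2 * q + 14) ->
    x ^ k <= B ^ ((2 * q + 14) * (q + 400 + C)).
  move=> kC xB; apply: (@leq_trans ((B ^ (2 * q + 14)) ^ k)).
    by case: k kC => [|k] _; [rewrite !expn0 | rewrite leq_exp2r].
  by rewrite -expnM leq_pexp2l // leq_mul2l kC orbT.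
apply: exec_comp; last apply: exec_comp (ex2 _) _.
  by apply: exec_leW ex1; apply: W_le V_le; rewrite leq_addr.
by apply: exec_leW exf; apply: W_le mag_le; rewrite leq_addl.
Qed.

(** * Exponential running times and the contradiction with SETH *)

Local Open Scope ring_scope.

Lemma exprn_le_powR2 (R : realType) (e : R) (a D : nat) : 0 < e ->
  exists2 K : R, 0 <= K & forall n : nat, (n + a)%:R ^+ D.+1 <= K * 2 `^ (e * n%:R).
Proof.
move=> e0; have ln2 : 0 < ln 2 :> R by rewrite ln_gt0 // ltr1n.
pose d : R := e * ln 2 / D.+1%:R.
have d0 : 0 < d by rewrite divr_gt0 ?mulr_gt0.
(* Since 2^(e n) is the (D+1)-st power of exp(d n) and exp(d n) >= 1 + d n, it suffices that b (1 +
   d n) >= n + a; the summand 1/d supplies n. *)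
pose b : R := a%:R + 1 + d^-1.
have b0 : 0 <= b by rewrite !addr_ge0 // invr_ge0 ltW.
exists (b ^+ D.+1) => [|n]; first exact: exprn_ge0.
have -> : 2 `^ (e * n%:R) = expR (d * n%:R) ^+ D.+1 :> R.
  rewrite -expRM_natl /powR gt_eqF // /d; congr expR.
  by field.
rewrite -exprMn lerXn2r ?nnegrE // ?mulr_ge0 ?expR_ge0 //.
apply: le_trans (ler_wpM2l b0 (expR_ge1Dx _)).
rewrite natrD /b.
have -> : (a%:R + 1 + d^-1) * (1 + d * n%:R) =
  n%:R + a%:R + (1 + d^-1 + (a%:R + 1) * (d * n%:R)) + (d^-1 * d - 1) * n%:R :> R by ring.
rewrite mulVf ?gt_eqF // subrr mul0r addr0 lerDl.
by rewrite !addr_ge0 // ?invr_ge0 ?mulr_ge0 ?addr_ge0 // ltW.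
Qed.

Lemma max_entry_const m : max_entry (const_mx 1 : 'cV[int]_m.+1) = 1.
Proof.
apply: (big_ind (fun x : int => x = 1)) => [|x y -> ->|i _]; rewrite ?mxE //.
Qed.

Section Reduction.
Variables (R : realType) (f : int -> R) (eps : R) (p : program) (C : nat).
Hypothesis eps_gt0 : 0 < eps.
Hypothesis ip_solved : forall (m n : nat) (A : 'M[int]_(m.+1, n.+1)) (b : 'cV[int]_m.+1),
  (forall i j, 0 <= A i j) ->
  exists2 t : nat, decides p C (encode_ip A b) (ip_feasible A b) t &
    let d := max_entry b in
    let k := path_width (column_matroid A) in
    0 <= d ->
    t%:R <= f d * (d + 1)%:~R `^ ((1 - eps) * k%:R) * (m.+1 * n.+1)%:R ^+ C.

(** Capping [eps] at 1 keeps the exponent 1 - e non-negative, so an upper bound on the path-width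
    may be inserted. *)
Let e : R := Num.min eps 1.

Let e_gt0 : 0 < e. Proof. by rewrite lt_min eps_gt0 ltr01. Qed.
Let e_le1 : e <= 1. Proof. by rewrite ge_min lexx orbT. Qed.

Lemma powR2_path_width N n (F : cnf n) : (n < N)%N ->
  2 `^ ((1 - eps) * (path_width (column_matroid (ip_mx N (size F) F)))%:R)
  <= 2 `^ ((1 - e) * (N + 4)%:R) :> R.
Proof.
move=> nN; apply: ler_powR; first by rewrite ler1n.
apply: le_trans (_ : (1 - e) * (path_width (column_matroid (ip_mx N (size F) F)))%:R <= _).
  by rewrite ler_wpM2r // lerD2l lerN2 ge_min lexx.
by rewrite ler_wpM2l ?subr_ge0 // ler_nat path_width_ip_mx.
Qed.

(** Half of the gain e is given up to absorb the factor polynomial in n; what remains polynomial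
    depends on the number of clauses only. *)
Lemma qsat_solvable_of_ip q : qsat_solvable q (1 - e / 2).
Proof.
(* The power D + 1 = 2C + 2 of the number of cells dominates both the matrix size to the power C and
   the quadratic time of the reduction. *)
pose D := (2 * C + 1)%N.
have [K K0 KP] := exprn_le_powR2 q.+1 D (divr_gt0 e_gt0 (ltr0Sn R 1)).
have [a aE] : exists a, a = (1202 * 15 + 201 * q.+1 + 1000 + (nregs (reduction q)).+1)%N.
  by eexists.
(* The path-width bound N + 4 equals n + (q + 5); [G] is the constant factor left after splitting
   off n. *)
pose G : R := 2 `^ ((1 - e) * (q + 5)%:R).
pose M : R := (a%:R + `|f 1| * G * 12 ^+ C) * K.
have M0 : 0 <= M.
  by rewrite mulr_ge0 // addr_ge0 // !mulr_ge0 ?powR_ge0 // exprn_ge0.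
pose C1 := ((2 * q + 14) * (q + 400 + C))%N.
exists (sat_program q p), (maxn (Num.trunc M).+1 (maxn D.+1 C1)) => n F qF.
set C2 := maxn _ _.
pose N := (n + q.+1)%N; pose m := size F.
have nN : (n < N)%N by rewrite /N; lia.
have N0 : (0 < N)%N by rewrite /N addnS.
have S0 : (0 < ncells N m)%N by rewrite muln_gt0 /N addnS.
have [|t dec tb] := @ip_solved _ _ (ip_mx N m F) (ip_rhs N m).
  by move=> i j; rewrite mxE.
have [t' dec' tt'] := sat_programP qF dec.
exists t'; first by apply: decides_leC dec'; rewrite /C2 leq_max leq_max leqnn !orbT.
(* Here d = 1, so f contributes the constant [f 1] and the base of the power is 2. *)
move: tb; rewrite /= max_entry_const => /(_ ler01).
have -> : ((nrows N m).-1.+1 * (ncols N m).-1.+1 = nrows N m * ncols N m)%N.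
  by rewrite (prednK (ncols_gt0 S0)) (prednK (nrows_gt0 S0)).
rewrite -[(1 + 1)%:~R]/(2%:R : R) => tb.
pose P : R := 2 `^ ((1 - e) * n%:R).
pose S := ncells N m.
have P1 : 1 <= P.
  rewrite -(powRr0 (2 : R)) ler_powR ?ler1n // mulr_ge0 // subr_ge0 //.
have t_le : t%:R <= `|f 1| * (P * G) * (12 ^+ C * S%:R ^+ D.+1).
  have Y_le : (nrows N m * ncols N m)%:R ^+ C <= 12 ^+ C * S%:R ^+ D.+1 :> R.
    rewrite -!natrX -natrM ler_nat; apply: (@leq_trans ((12 * S ^ 2) ^ C)%N).
      case: (C) => [|c]; first by rewrite !expn0.
      by rewrite leq_exp2r // size_ip_mx_le.
    rewrite expnMn leq_mul2l -expnM; apply/orP; right.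
    by rewrite leq_pexp2l // /D addn1 (leqW (leqnSn _)).
  have X_le := powR2_path_width F nN.
  have X_eq : 2 `^ ((1 - e) * (N + 4)%:R) = P * G :> R.
    rewrite /P /G -powRD; last by rewrite pnatr_eq0 implybT.
    by rewrite -mulrDr -natrD /N -addnA addSnnS.
  rewrite X_eq in X_le; apply: le_trans tb _.
  apply: (@le_trans _ _ (`|f 1| * 2 `^ ((1 - eps) *
     (path_width (column_matroid (ip_mx N m F)))%:R) * (nrows N m * ncols N m)%:R ^+ C)).
    by rewrite ler_wpM2r ?exprn_ge0 // ler_wpM2r ?powR_ge0 // ler_norm.
  by rewrite ler_pM ?mulr_ge0 ?powR_ge0 ?exprn_ge0 // ler_wpM2l.
have t'_le : t'%:R <= a%:R * S%:R ^+ D.+1 + t%:R :> R.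
  rewrite -natrX -natrM -natrD ler_nat; apply: (leq_trans tt'); rewrite leq_add2r.
  rewrite aE; apply: leq_trans (reduction_time_le _ _ _ N0) _.
  by rewrite leq_mul2l leq_pexp2l ?orbT // /D addn1.
have S_le : S%:R ^+ D.+1 <= (m.+1%:R ^+ D.+1) * (K * 2 `^ (e / 2 * n%:R)) :> R.
  by rewrite /S /ncells natrM exprMn ler_wpM2l ?exprn_ge0 ?KP.
have pow_split : 2 `^ ((1 - e / 2) * n%:R) = P * 2 `^ (e / 2 * n%:R) :> R.
  rewrite /P -powRD; last by rewrite pnatr_eq0 implybT.
  by congr (_ `^ _); field.
apply: (@le_trans _ _ (M * 2 `^ ((1 - e / 2) * n%:R) * m.+1%:R ^+ D.+1)).
  apply: (@le_trans _ _ ((a%:R + `|f 1| * G * 12 ^+ C) * P * S%:R ^+ D.+1)).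
    apply: le_trans t'_le _; rewrite 2!mulrDl; apply: lerD.
      by rewrite ler_wpM2r ?exprn_ge0 // ler_peMr.
    apply: le_trans t_le _; rewrite le_eqVlt; apply/orP; left; apply/eqP; ring.
  rewrite pow_split /M; apply: le_trans (ler_wpM2l _ S_le) _.
    by rewrite !mulr_ge0 ?addr_ge0 ?powR_ge0 // !mulr_ge0 ?powR_ge0 ?exprn_ge0.
  by rewrite le_eqVlt; apply/orP; left; apply/eqP; ring.
apply: ler_pM; [exact: mulr_ge0 M0 (powR_ge0 _ _) | exact: exprn_ge0 | |].
  rewrite ler_wpM2r ?powR_ge0 //; apply: le_trans (ltW (truncnS_gt M)) _.
  by rewrite ler_nat /C2 leq_maxl.
by apply: ler_weXn2l; rewrite ?ler1n // /C2 !leq_max leqnn orbT.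
Qed.
End Reduction.

Theorem theorem5 (R : realType) :
  SETH R ->
  forall (f : int -> R) (eps : R), 0 < eps ->
  ~ exists (p : program) (C : nat),
      forall (m n : nat) (A : 'M[int]_(m.+1, n.+1)) (b : 'cV[int]_m.+1),
        (forall i j, 0 <= A i j) ->
        exists2 t : nat, decides p C (encode_ip A b) (ip_feasible A b) t &
          let d := max_entry b in
          let k := path_width (column_matroid A) in
          0 <= d ->
          t%:R <= f d * (d + 1)%:~R `^ ((1 - eps) * k%:R)
                    * (m.+1 * n.+1)%:R ^+ C.
Proof.
move=> seth f eps eps0 [p [C H]].
have sat := qsat_solvable_of_ip eps0 H.
have e0 : 0 < Num.min eps 1 by rewrite lt_min eps0 ltr01.
(* Every [delta R q] is at most 1 - e/2 with the same e > 0, so their limit cannot be 1. *)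
have := cvge_to_le seth (b := (1 - Num.min eps 1 / 2)%:E).
rewrite lee_fin => H'.
suff : 1 <= 1 - Num.min eps 1 / 2 by lra.
apply: H'; near=> q.
by apply: ereal_inf_lbound; exists (1 - Num.min eps 1 / 2) => //; exact: sat.
Unshelve. all: by end_near. Qed.
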